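(* There is a polynomial time algorithm that, given integers $m\ge 1$, $0\le b\le m$ and a multiset $U=\{u_1\le u_2\le\dots\le u_b\}\subset(0,1)$ of inverse bike speeds, constructs an arrival-time optimal schedule for the Relaxed Bike Sharing problem when at most one bike can be abandoned: a feasible schedule $(X,M)$ in which at most one bike is abandoned and such that $\tau(X,M)\le\tau(X',M')$ for every feasible schedule $(X',M')$ in which at most one bike is abandoned.
   Context: There are $m$ agents and $b$ bikes, all starting at the point $0$ of the interval $[0,1]$. Bike $k$ has inverse speed $u_k$; label $0$ denotes walking, with inverse speed $1$. A schedule of size $n$ is a pair $(X,M)$, where $X=(x_1,\dots,x_n)$ satisfies $x_j\ge 0$ and $\sum_j x_j=1$ (consecutive subintervals of $[0,1]$ and their lengths), and $M$ is an $m\times n$ matrix with entries in $\{0,1,\dots,b\}$; $M(i,j)$ is the label of the bike used by agent $i$ on subinterval $x_j$ ($0$ if agent $i$ walks). Let $\widetilde M(i,j)=u_{M(i,j)}$ if $M(i,j)\ne 0$ and $\widetilde M(i,j)=1$ if $M(i,j)=0$. Put $t_{i,j}=\sum_{k=1}^{j}\widetilde M(i,k)x_k$, $t_i=t_{i,n}$ (arrival time of agent $i$), and $\tau(X,M)=\max_i t_i$. $(X,M)$ is feasible if: (1) for $j\ge2$, $M(i,j)\ne0$ implies there is $i'$ with $M(i',j-1)=M(i,j)$; (2) $M(i,j)\ne 0$ implies $M(i',j)\ne M(i,j)$ for all $i'\ne i$; (3) for $j\ge 2$, $M(i,j)=M(i',j-1)\neq0$ implies $t_{i',j-1}\le t_{i,j-1}$.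 For a feasible schedule let $y_k\in[0,1]$ be the total distance for which bike $k$ is used, i.e. the sum of $x_j$ over all $j$ such that $M(i,j)=k$ for some $i$. Bike $k$ is abandoned (at position $y_k$) if $y_k<1$. The Relaxed Bike Sharing problem asks for a feasible schedule minimizing $\tau(X,M)$; with abandonment limit $1$ only feasible schedules in which at most one bike is abandoned are admitted. *)

(* Defs.v *)
From HB Require Import structures.
From mathcomp Require Import all_boot all_order all_algebra.
From mathcomp Require Import reals.

Set Implicit Arguments.
Unset Strict Implicit.
Unset Printing Implicit Defensive.

Import Order.TTheory GRing.Theory Num.Theory.
Local Open Scope ring_scope.

(** * Schedules *)

(** The [k]-th bike, [1 <= k <= b], has inverse speed [u`_k.-1]; the label
    [0] stands for walking.  A schedule of size [n] is a pair [(x, M)] with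
    [x : 'rV[R]_n] and [M : 'M['I_b.+1]_(m, n)].  Agents and subintervals are
    numbered from [0]. *)

Section Schedules.
Variables (R : realType) (m b : nat) (u : b.-tuple R).

Definition inv_speed (k : 'I_b.+1) : R :=
  if val k is k'.+1 then u`_k' else 1.

Section Size.
Variables (n : nat) (x : 'rV[R]_n) (M : 'M['I_b.+1]_(m, n)).

Definition time (i : 'I_m) (j : 'I_n) : R :=
  \sum_(k < n | (k <= j)%N) inv_speed (M i k) * x 0 k.

Definition arrival (i : 'I_m) : R :=
  \sum_(k < n) inv_speed (M i k) * x 0 k.

(** The default value [0] is harmless: arrival times are nonnegative as soon
    as the entries of [u] and [x] are. *)
Definition makespan : R := \big[Num.max/0]_(i < m) arrival i.

Definition is_subdivision : Prop :=
  (forall j, 0 <= x 0 j) /\ \sum_(j < n) x 0 j = 1.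

(** In the first and third clauses [j] is the subinterval right after [j']. *)
Definition bike_available : Prop :=
  forall (i : 'I_m) (j' j : 'I_n), j = j'.+1 :> nat ->
    M i j != ord0 -> exists i' : 'I_m, M i' j' = M i j.

Definition bike_exclusive : Prop :=
  forall (i : 'I_m) (j : 'I_n), M i j != ord0 ->
    forall i' : 'I_m, i' != i -> M i' j != M i j.

Definition bike_on_time : Prop :=
  forall (i i' : 'I_m) (j' j : 'I_n), j = j'.+1 :> nat ->
    M i j = M i' j' -> M i' j' != ord0 -> time i' j' <= time i j'.

Definition feasible : Prop :=
  [/\ is_subdivision, bike_available, bike_exclusive & bike_on_time].

Definition bike_dist (k : 'I_b.+1) : R :=
  \sum_(j < n | [exists i, M i j == k]) x 0 j.

Definition abandoned : {set 'I_b.+1} :=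
  [set k | (k != ord0) && (bike_dist k < 1)].

Definition feasible_le1 : Prop := feasible /\ (#|abandoned| <= 1)%N.

End Size.

Definition optimal_le1 n (x : 'rV[R]_n) (M : 'M['I_b.+1]_(m, n)) : Prop :=
  feasible_le1 x M /\
  forall n' (x' : 'rV[R]_n') (M' : 'M['I_b.+1]_(m, n')),
    feasible_le1 x' M' -> makespan x M <= makespan x' M'.

End Schedules.

(** * A real RAM *)

(** Inverse speeds are arbitrary reals, so the machine model is the real RAM:
    a fixed program works on finitely many named arrays of natural numbers and
    of reals, each indexed by two natural numbers.  Reals are added,
    subtracted, multiplied, divided ([x / 0 = 0]) and compared exactly; there is no floor
    function.  Natural numbers, used as indices and labels, are only added,
    subtracted (truncated) and compared, so that a run of [t] steps creates
    naturals of [O(t)] more bits than those in the input. *)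

Inductive iexp : Type :=
| ICst of nat
| IGet of nat & iexp & iexp
| IAdd of iexp & iexp
| ISub of iexp & iexp.

Inductive rexp : Type :=
| ROfI of iexp
| RGet of nat & iexp & iexp
| RAdd of rexp & rexp
| RSub of rexp & rexp
| RMul of rexp & rexp
| RDiv of rexp & rexp.

Inductive bexp : Type :=
| ILe of iexp & iexp
| RLe of rexp & rexp
| BNot of bexp
| BAnd of bexp & bexp.

Inductive cmd : Type :=
| Skip
| ISet of nat & iexp & iexp & iexp
| RSet of nat & iexp & iexp & rexp
| Seq of cmd & cmd
| If of bexp & cmd & cmd
| While of bexp & cmd.

Section Semantics.
Variable R : realType.

Record store : Type := Store {
  icell : nat -> nat -> nat -> nat;
  rcell : nat -> nat -> nat -> R }.

Fixpoint ieval (s : store) (e : iexp) : nat :=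
  match e with
  | ICst n => n
  | IGet a e1 e2 => icell s a (ieval s e1) (ieval s e2)
  | IAdd e1 e2 => (ieval s e1 + ieval s e2)%N
  | ISub e1 e2 => (ieval s e1 - ieval s e2)%N
  end.

Fixpoint reval (s : store) (e : rexp) : R :=
  match e with
  | ROfI e1 => (ieval s e1)%:R
  | RGet a e1 e2 => rcell s a (ieval s e1) (ieval s e2)
  | RAdd e1 e2 => reval s e1 + reval s e2
  | RSub e1 e2 => reval s e1 - reval s e2
  | RMul e1 e2 => reval s e1 * reval s e2
  | RDiv e1 e2 => reval s e1 / reval s e2
  end.

Fixpoint beval (s : store) (e : bexp) : bool :=
  match e with
  | ILe e1 e2 => (ieval s e1 <= ieval s e2)%N
  | RLe e1 e2 => reval s e1 <= reval s e2
  | BNot e1 => ~~ beval s e1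
  | BAnd e1 e2 => beval s e1 && beval s e2
  end.

Definition upd T (f : nat -> nat -> nat -> T) (a i j : nat) (v : T) :=
  fun a' i' j' => if [&& a' == a, i' == i & j' == j] then v else f a' i' j'.

(** [exec c s t s']: started in [s], the program [c] halts in [s'] after [t]
    steps.  Assignments and tests cost one step each; the expressions they
    evaluate have a size fixed by the program, so this agrees with counting
    elementary operations up to a constant factor. *)
Inductive exec : cmd -> store -> nat -> store -> Prop :=
| ExecSkip s : exec Skip s 1 s
| ExecISet s a e1 e2 e :
    exec (ISet a e1 e2 e) s 1
      (Store (upd (icell s) a (ieval s e1) (ieval s e2) (ieval s e)) (rcell s))
| ExecRSet s a e1 e2 e :
    exec (RSet a e1 e2 e) s 1
      (Store (icell s) (upd (rcell s) a (ieval s e1) (ieval s e2) (reval s e)))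
| ExecSeq c1 c2 s1 s2 s3 t1 t2 :
    exec c1 s1 t1 s2 -> exec c2 s2 t2 s3 ->
    exec (Seq c1 c2) s1 (t1 + t2)%N s3
| ExecIf e c1 c2 s s' t :
    exec (if beval s e then c1 else c2) s t s' ->
    exec (If e c1 c2) s t.+1 s'
| ExecWhileEnd e c s : ~~ beval s e -> exec (While e c) s 1 s
| ExecWhileStep e c s1 s2 s3 t1 t2 :
    beval s1 e -> exec c s1 t1 s2 -> exec (While e c) s2 t2 s3 ->
    exec (While e c) s1 (t1 + t2).+1 s3.

(** Input: [m] and [b] in cell [(0, 0)] of the arrays [0] and [1] of naturals, and
    [u`_k] in cell [(k, 0)] of the array [0] of reals; every other cell is [0]. *)
Definition input (m b : nat) (u : b.-tuple R) : store :=
  Store (fun a i j => match a, i, j with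
                      | 0, 0, 0 => m
                      | 1, 0, 0 => b
                      | _, _, _ => 0
                      end%N)
        (fun a k j => if (a == 0%N) && (j == 0%N) then u`_k else 0).

(** Output: [n] in cell [(0, 0)] of the array [2] of naturals, the length [x 0 j]
    in cell [(j, 0)] of the array [1] of reals, and [M i j] in cell
    [(i, j)] of the array [3] of naturals. *)
Definition outputs m b n (s : store)
    (x : 'rV[R]_n) (M : 'M['I_b.+1]_(m, n)) : Prop :=
  [/\ icell s 2 0 0 = n,
      forall j : 'I_n, rcell s 1 j 0 = x 0 j
    & forall (i : 'I_m) (j : 'I_n), icell s 3 i j = M i j].

End Semantics.

(* Main.v *)
Require Import Defs.
From HB Require Import structures.
From mathcomp Require Import all_boot all_order all_algebra.
From mathcomp Require Import reals.
From mathcomp Require Import lra zify.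

Set Implicit Arguments.
Unset Strict Implicit.
Unset Printing Implicit Defensive.

Import Order.TTheory GRing.Theory Num.Theory.
Local Open Scope ring_scope.

(** Write [u1], [up], [ub] for the inverse speeds of the fastest, the second
    slowest and the slowest bike, and suppose that the latter is used up to
    [y].

    Lower bound.  Summing over the agents, [m tau] is at least [m] minus the
    sum of [(1 - u_k) y_k]; the last rider of bike [b] arrives no earlier than
    [ub y + u1 (1 - y)]; and one of the two slowest bikes is not abandoned, so
    [tau >= up].  When [ub] is at most the average [A] of all labels the first
    bound gives [tau >= A]; otherwise eliminating [y] from the first two gives
    a second threshold, and [T] is its maximum with [up].

    Matching schedule.  Keep one composite vehicle, "bike [k] up to [z], then
    walk", together with untouched bikes and walkers, of average at most [T].
    If the composite takes at least [T], the next agent follows it up to some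
    [p >= z] and then takes a fresh bike [s], arriving at [T] exactly; what is
    left over is the composite "bike [s] up to [p], then walk".  If it takes
    less than [T], the next agent walks up to some [q <= z], takes bike [k] up
    to [z], and walks again; "bike [k] up to [q], then walk" is left over.
    When [ub > T] the initial composite is bike [b] up to the [y] for which
    [ub y + u1 (1 - y) = T]. *)

(** * The greedy assignment *)

Section Greedy.
Variable R : realType.

Record agent := Agent {
  lab1 : nat; lab2 : nat; lab3 : nat; brk1 : R; brk2 : R }.

Definition label (a : agent) (p : R) : nat :=
  if p <= brk1 a then lab1 a else if p <= brk2 a then lab2 a else lab3 a.

(* [State z k s w]: the composite vehicle uses bike [k] up to [z] and then
   walks; bikes [s], ..., [b - 1] and [w] walkers are left. *)
Record state := State { comp_end : R; comp_bike : nat; next_bike : nat; walkers : nat }.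

Variables (v : nat -> R) (b : nat) (T : R).

Definition travel (a : agent) (p : R) : R :=
  v (lab1 a) * Num.min p (brk1 a)
  + v (lab2 a) * (Num.min p (brk2 a) - Num.min p (brk1 a))
  + v (lab3 a) * (p - Num.min p (brk2 a)).

Definition comp_time (st : state) : R :=
  v (comp_bike st) * comp_end st + (1 - comp_end st).

(** [p] and [q] solve the linear equations saying that the new agent arrives at [T] exactly. The
    last two cases cover a missing partner: with no walker left a fresh bike is ridden alone
    throughout, and with no bike left someone walks throughout. *)
Definition step (st : state) : agent * state :=
  let: State z k s w := st in
  if (T <= comp_time st) && (s < b)%N then
    let p := (T - v k * z + z - v s) / (1 - v s) in
    (Agent k 0 s z p, State p s s.+1 w)
  else if ~~ (T <= comp_time st) && (0 < w)%N then
    let q := (T - comp_time st) / (1 - v k) in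
    (Agent 0 k 0 q z, State q k s w.-1)
  else if (s < b)%N then (Agent s s s 1 1, State z k s.+1 w)
  else (Agent 0 0 0 1 1, State z k s w.-1).

Definition last_agent (st : state) : agent :=
  Agent (comp_bike st) 0 0 (comp_end st) 1.

(* A giver of bike [k] reaches the point [p] no later than [handover k p], and
   a taker no earlier, so that being on time becomes a condition on each agent
   separately.  The [Num.max] only matters for the abandoned bike. *)
Definition handover (k : nat) (p : R) : R :=
  Num.min p (Num.max T (v k) - v k * (1 - p)).

(** Give conditions concern the vehicle left at a breakpoint, take conditions the bike picked up
    there. The equality alternatives cover breakpoints at which the agent keeps its bike. *)
Record valid_agent (a : agent) : Prop := ValidAgent {
  valid_lab1 : (lab1 a <= b)%N;
  valid_lab2 : (lab2 a <= b)%N;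
  valid_lab3 : (lab3 a <= b)%N;
  valid_brk1 : 0 <= brk1 a;
  valid_brk12 : brk1 a <= brk2 a;
  valid_brk2 : brk2 a <= 1;
  valid_travel : travel a 1 <= T;
  valid_give1 : v (lab1 a) * brk1 a <= handover (lab1 a) (brk1 a);
  valid_give2 : v (lab1 a) * brk1 a + v (lab2 a) * (brk2 a - brk1 a)
                  <= handover (lab2 a) (brk2 a);
  valid_take2 : lab2 a != 0%N -> lab1 a = lab2 a \/
    handover (lab2 a) (brk1 a) <= v (lab1 a) * brk1 a;
  valid_take3 : lab3 a != 0%N -> (lab1 a = lab3 a /\ lab2 a = lab3 a) \/
    handover (lab3 a) (brk2 a)
      <= v (lab1 a) * brk1 a + v (lab2 a) * (brk2 a - brk1 a) }.

Definition bikes_left (st : state) : R := \sum_(next_bike st <= l < b) v l.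

(** [valid_sum] says that the vehicles still to be assigned average at most [T]. The second case of
    [valid_comp] allows an initial composite whose bike has inverse speed above [T]; the first step
    then replaces that bike by one of inverse speed at most [T]. *)
Record valid_state (st : state) : Prop := ValidState {
  valid_end : 0 <= comp_end st <= 1;
  valid_bike : (comp_bike st <= b)%N;
  valid_next : (0 < next_bike st)%N;
  valid_comp : v (comp_bike st) <= T \/
    [/\ T <= comp_time st, (next_bike st < b)%N
      & v (comp_bike st) * comp_end st + v (next_bike st) * (1 - comp_end st) <= T];
  valid_sum : comp_time st + bikes_left st + (walkers st)%:R
    <= T * (1 + (b - next_bike st) + walkers st)%:R }.

Hypothesis v0 : v 0 = 1.
Hypothesis v_bike : forall k, (0 < k <= b)%N -> 0 < v k < 1.
Hypothesis v_le : forall k, (0 < k < b)%N -> v k <= T.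
Hypothesis T_le1 : T <= 1.

Lemma v_bounds k : (k <= b)%N -> 0 < v k <= 1.
Proof.
case: k => [|k] kb; first by rewrite v0 ltr01 lexx.
by have /andP[-> /ltW ->] := @v_bike k.+1 kb.
Qed.

(** With [handover_le], this trades the minimum and the maximum for linear inequalities, within
    reach of [lra]. *)
Lemma le_handover k p t :
  (t <= handover k p) = (t <= p) &&
    ((t + v k * (1 - p) <= T) || (t + v k * (1 - p) <= v k)).
Proof. by rewrite /handover le_min lerBrDr le_max. Qed.

Lemma handover_le k p t :
  (handover k p <= t) = (p <= t) ||
    ((T <= t + v k * (1 - p)) && (v k <= t + v k * (1 - p))).
Proof. by rewrite /handover ge_min lerBlDr ge_max. Qed.

Lemma travel1 a : brk1 a <= 1 -> brk2 a <= 1 ->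
  travel a 1 = v (lab1 a) * brk1 a + v (lab2 a) * (brk2 a - brk1 a)
     + v (lab3 a) * (1 - brk2 a).
Proof. by move=> h1 h2; rewrite /travel !(min_r h1) !(min_r h2). Qed.

Lemma convex_le (x y t p : R) : 0 <= p <= 1 -> x <= t -> y <= t ->
  x * p + y * (1 - p) <= t.
Proof.
move=> /andP[p0 p1] xt yt.
have h1 : x * p <= t * p by rewrite ler_wpM2r.
have h2 : y * (1 - p) <= t * (1 - p) by rewrite ler_wpM2r // subr_ge0.
lra.
Qed.

(** An agent arriving at [T] exactly takes [T] off both sides of [valid_sum]. Takers are on time:
    bike [s] is picked up at time [T - v s * (1 - p)], its handover time, while bike [k] is picked
    up after walking to [q], and a handover time never exceeds the position. *)
Lemma step_valid st : valid_state st -> (0 < (b - next_bike st) + walkers st)%N ->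
  [/\ valid_agent (step st).1, valid_state (step st).2
    & ((b - next_bike (step st).2) + walkers (step st).2
        = ((b - next_bike st) + walkers st).-1)%N].
Proof.
have T1 := T_le1.
case: st => z k s w [/= /andP[z0 z1] kb s0 hc hsum] hpos.
have /andP[vk0 vk1] := v_bounds kb.
have vkz : v k * z <= z by rewrite ler_piMl.
have hC : comp_time (State z k s w) = v k * z + (1 - z) by [].
rewrite /step; set C := comp_time _ in hC hc hsum *; clearbody C.
case: ifP => [/andP[TC sb]|h1].
  have /andP[vs0 vs1] : 0 < v s < 1 by apply: v_bike; rewrite s0 ltnW.
  have vsT : v s <= T by apply: v_le; rewrite s0.
  set p := _ / _.
  have pE : p * (1 - v s) = T - v k * z + z - v s.
    by rewrite /p divfK // subr_eq0 gt_eqF.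
  (* [z <= p] amounts to this bound, and [p <= 1] to [T <= C]. *)
  have hz : v k * z + v s * (1 - z) <= T.
    by case: hc => [vkT|[_ _]//]; apply: convex_le; rewrite ?z0.
  have vs1' : 0 < 1 - v s by lra.
  have zp : z <= p by rewrite -(ler_pM2r vs1'); lra.
  have p1 : p <= 1 by rewrite -(ler_pM2r vs1'); lra.
  split=> /=.
  - clear hsum; split=> //=; first exact: ltnW.
    + by rewrite travel1 //= v0; lra.
    + rewrite le_handover; apply/andP; split; first by lra.
      by apply/orP; right; lra.
    + rewrite le_handover v0; apply/andP; split; first by lra.
      by apply/orP; right; lra.
    + by move=> _; right; rewrite handover_le v0; apply/orP; right; apply/andP; split; lra.
  - split=> //=.
    + by rewrite (le_trans z0 zp).
    + exact: ltnW.
    + by left.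
    + move: hsum; rewrite /bikes_left /comp_time /= big_ltn //=.
      have -> : (1 + (b - s) + w = (1 + (b - s.+1) + w).+1)%N by clear -sb; lia.
      rewrite -natr1.
      by move: (\sum_(_ <= _ < _) _) w%:R (1 + (b - s.+1) + w)%:R => S W N; lra.
  - clear -sb; lia.
case: ifP => [/andP[TC w0]|h2].
  rewrite -ltNge in TC.
  have vkT : v k <= T by case: hc => // -[]; rewrite leNgt TC.
  (* A composite moving at walking speed would take time [1], which is not below [T]. *)
  have vk_lt1 : v k < 1.
    rewrite lt_neqAle vk1 andbT; apply/eqP => vE.
    by move: TC; rewrite hC vE mul1r; lra.
  have vk1' : 0 < 1 - v k by lra.
  set q := _ / _.
  have qE : q * (1 - v k) = T - C by rewrite /q divfK // subr_eq0 gt_eqF.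
  (* [0 <= q] amounts to [C <= T], and [q <= z] to [T <= 1]. *)
  have q0 : 0 <= q by rewrite -(ler_pM2r vk1'); lra.
  have qz : q <= z by rewrite -(ler_pM2r vk1'); lra.
  have hq : 0 <= (1 - v k) * (z - q) by rewrite mulr_ge0 ?subr_ge0.
  have hz : 0 <= (1 - v k) * (1 - z) by rewrite mulr_ge0 ?subr_ge0.
  split=> /=.
  - clear hsum; split=> //=.
    + by rewrite travel1 //= ?v0 ?(le_trans qz) //; lra.
    + by rewrite v0 mul1r le_handover lexx v0 mul1r; apply/orP; right; lra.
    + rewrite v0 mul1r le_handover; apply/andP; split; first by lra.
      by apply/orP; left; lra.
    + by move=> _; right; rewrite handover_le v0 mul1r lexx.
  - split=> //=.
    + by rewrite q0 (le_trans qz).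
    + by left.
    + move: hsum; rewrite /bikes_left /=.
      have -> : (1 + (b - s) + w = (1 + (b - s) + w.-1).+1)%N by clear -w0; lia.
      rewrite -[_.+1%:R]natr1 -{1}(prednK w0) -[_.+1%:R]natr1 /comp_time [comp_end _]/= [comp_bike _]/=.
      by move: (\sum_(_ <= _ < _) _) w.-1%:R (1 + (b - s) + w.-1)%:R => S W N; lra.
  - clear -w0; lia.
case: ifP => [sb|sb].
  have TC : C < T by rewrite ltNge; move: h1; rewrite sb andbT => ->.
  have vkT : v k <= T by case: hc => // -[]; rewrite leNgt TC.
  have w0 : w = 0%N by move: h2; rewrite leNgt TC /= lt0n => /negbT/negPn/eqP.
  have /andP[vs0 vs1] : 0 < v s < 1 by apply: v_bike; rewrite s0 ltnW.
  have vsT : v s <= T by apply: v_le; rewrite s0.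
  split=> /=.
  - clear hsum; split=> //=; rewrite ?(ltnW sb) //.
    + by rewrite travel1 //=; lra.
    + by rewrite le_handover; apply/andP; split; [lra|apply/orP; left; lra].
    + by rewrite le_handover; apply/andP; split; [lra|apply/orP; left; lra].
    + by left.
    + by left.
  - split=> //=; first by rewrite z0.
    + by left.
    (* Removing a bike faster than the average may raise the average, so the old sum is of no help.
       Instead the new one is bounded term by term: [C < T], and each remaining bike is at most
       [T]. *)
    + rewrite /bikes_left /= w0 !addr0 addn0.
      rewrite natrD mulrDr mulr1 lerD //; first by move: TC; rewrite hC => /ltW.
      have -> : T * (b - s.+1)%:R = \sum_(s.+1 <= l < b) T.
        by rewrite sumr_const_nat mulr_natr.
      rewrite big_nat_cond [leRHS]big_nat_cond; apply: ler_sum => l /andP[/andP[sl lb] _].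
      by apply: v_le; rewrite lb andbT (leq_ltn_trans _ sl).
  - clear -sb w0; lia.
have w0 : (0 < w)%N by clear -hpos sb; lia.
have TC : T <= C by move: h2; rewrite w0 andbT => /negbFE.
have bs : (b <= s)%N by rewrite leqNgt sb.
have vkT : v k <= T by case: hc => // -[_]; rewrite sb.
(* The composite takes at least [T] and all other vehicles are walkers; an average of at most [T]
   then forces [1 <= T]. *)
have TE : T = 1.
  move: hsum; rewrite /bikes_left /= big_geq // addr0.
  have -> : (1 + (b - s) + w = w.+1)%N by clear -bs; lia.
  have w0R : 0 < w%:R :> R by rewrite ltr0n.
  rewrite -natr1; move: w%:R w0R => W w0R hsum'.
  apply/eqP; rewrite eq_le T_le1 /=.
  by rewrite -(ler_pM2r w0R); lra.
split=> /=.
- clear hsum; split=> //=.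
  + by rewrite travel1 //= v0; lra.
  + by rewrite le_handover v0; apply/andP; split; [lra|apply/orP; right; lra].
  + by rewrite le_handover v0; apply/andP; split; [lra|apply/orP; right; lra].
- split=> //=; first by rewrite z0.
  + by left.
  + move: hsum; rewrite hC /bikes_left /comp_time /=.
    have -> : (1 + (b - s) + w = (1 + (b - s) + w.-1).+1)%N by clear -w0; lia.
    rewrite -[_.+1%:R]natr1 -{1}(prednK w0) -[_.+1%:R]natr1 TE.
    by move: (\sum_(_ <= _ < _) _) w.-1%:R (1 + (b - s) + w.-1)%:R => S W N; lra.
- clear -w0 bs; lia.
Qed.

(** With nothing else left, [valid_sum] bounds the time of the composite alone. *)
Lemma last_agent_valid st : valid_state st -> (b <= next_bike st)%N ->
  walkers st = 0%N -> valid_agent (last_agent st).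
Proof.
have T1 := T_le1.
case: st => z k s w [/= /andP[z0 z1] kb s0 hc hsum] bs w0.
have /andP[vk0 vk1] := v_bounds kb.
have vkz : v k * z <= z by rewrite ler_piMl.
split=> //=.
- rewrite travel1 //= v0; move: hsum; rewrite w0 /bikes_left /comp_time /= big_geq //.
  have -> : (1 + (b - s) + 0 = 1)%N by clear -bs; lia.
  lra.
- by rewrite le_handover; apply/andP; split; [lra|apply/orP; right; lra].
- by rewrite le_handover v0; apply/andP; split; [lra|apply/orP; right; lra].
Qed.

(* How often the composite vehicle and the remaining bikes use bike [k] at the
   point [p]. *)
Definition usage (st : state) (p : R) (k : nat) : nat :=
  ((p <= comp_end st) && (comp_bike st == k)) + (next_bike st <= k < b)%N.

(** Bikes are cut, never lost or duplicated: whatever stretch of a bike the agent leaves over goes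
    into the new composite. In the first case the agent uses up [k], and [s] is split at [p]. *)
Lemma step_usage st p k : valid_agent (step st).1 ->
  (0 < k)%N -> p <= 1 ->
  ((label (step st).1 p == k) + usage (step st).2 p k = usage st p k)%N.
Proof.
move=> va k0 p1; case: k k0 => // k _.
have := valid_brk12 va; clear va.
case: st => z l s w; rewrite /step /label /usage.
have sub (x y : R) : x <= y -> (p <= x) ==> (p <= y).
  by move=> xy; apply/implyP => /le_trans; apply.
case: ifP => [/andP[_ sb]|_] /=.
  by move=> /sub; case: (p <= z); case: (p <= _) => //= _;
    do ?case: eqVneq => ?; lia.
case: ifP => [_|_] /=.
  by move=> /sub; case: (p <= z); case: (p <= _) => //= _;
    do ?case: eqVneq => ?; lia.
by case: ifP => sb; rewrite /= p1 => _;
    do ?case: eqVneq => ?; lia.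
Qed.

(** * Iterating the greedy step over the agents *)

Section Run.
Variables (m : nat) (st0 : state).
Hypotheses (m_gt0 : (0 < m)%N) (st0_valid : valid_state st0).
Hypothesis st0_size : ((b - next_bike st0) + walkers st0 = m.-1)%N.

Definition state_at (i : nat) : state := iter i (fun st => (step st).2) st0.
Definition agent_at (i : nat) : agent :=
  if (i < m.-1)%N then (step (state_at i)).1 else last_agent (state_at m.-1).

Lemma state_at_valid i : (i <= m.-1)%N ->
  valid_state (state_at i) /\
  ((b - next_bike (state_at i)) + walkers (state_at i) = m.-1 - i)%N.
Proof.
elim: i => [|i IH] im; first by rewrite subn0.
have [va si] := IH (ltnW im).
have [|_ h1 h2] := step_valid va; first by rewrite si subn_gt0.
by split => //; rewrite [LHS]h2 si subnS.
Qed.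

Lemma agent_at_valid i : valid_agent (agent_at i).
Proof.
rewrite /agent_at; case: ifP => im.
  have [va si] := state_at_valid (ltnW im).
  by have [|h _ _] := step_valid va; rewrite ?si ?subn_gt0.
have [va] := state_at_valid (leqnn _); rewrite subnn => /eqP.
by rewrite addn_eq0 subn_eq0 => /andP[? /eqP ?]; apply: last_agent_valid.
Qed.

(** [step_usage] telescopes, and the last agent absorbs the final composite. *)
Lemma agents_usage p k : (0 < k)%N -> p <= 1 ->
  (\sum_(i < m) (label (agent_at i) p == k) = usage st0 p k)%N.
Proof.
move=> k0 p1.
have inv i : (i <= m.-1)%N ->
  (\sum_(i' < i) (label (agent_at i') p == k) + usage (state_at i) p k = usage st0 p k)%N.
  elim: i => [|i IH] im; first by rewrite big_ord0.
  rewrite -(IH (ltnW im)) big_ord_recr /= -addnA; congr addn.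
  have va := agent_at_valid i; rewrite /agent_at im in va *.
  by rewrite step_usage.
rewrite -(prednK m_gt0) big_ord_recr /= -(inv _ (leqnn _)); congr addn.
have [va] := state_at_valid (leqnn _); rewrite subnn => /eqP.
rewrite addn_eq0 subn_eq0 => /andP[bs _].
rewrite /agent_at ltnn /usage /label /= p1; case: ifP => _ /=.
  by case: eqVneq => _; lia.
clear inv; by case: k k0 => // k _; lia.
Qed.

End Run.
End Greedy.

(** * Cutting at the breakpoints *)

Section NextBreak.
Variable R : realType.
Implicit Types (p r d : R) (D : seq R).

Definition tighten p r d := if (p < d) && (d < r) then d else r.

(** The least element of [D] strictly between [p] and [1], or [1] if there is none. The left fold
    mirrors the scan made by the program, which thus needs no sorting. *)
Definition next_break D p := foldl (tighten p) 1 D.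

(* [0] followed by the sorted breakpoints, then constantly [1]. *)
Definition break_at D j := iter j (next_break D) 0.

Lemma next_break_rcons D d p :
  next_break (rcons D d) p = tighten p (next_break D p) d.
Proof. by rewrite /next_break foldl_rcons. Qed.

Lemma next_break_ge D p : p <= 1 -> p <= next_break D p <= 1.
Proof.
move=> p1; elim/last_ind: D => [|D d IH]; first by rewrite /next_break /= p1 lexx.
rewrite next_break_rcons /tighten; case: ifP => // /andP[/ltW -> dr].
by case/andP: IH => _; apply: le_trans; apply: ltW.
Qed.

Lemma next_break_gap D d p : d \in D -> d <= p \/ next_break D p <= d.
Proof.
elim/last_ind: D => // D d' IH; rewrite mem_rcons in_cons next_break_rcons.
rewrite /tighten; case/orP => [/eqP <-|/IH].
  by case: (ltP p d) => pd; [right; case: ltP|left].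
case: ifP => [/andP[_ dr]|_] // [|h]; [by left|right].
by rewrite (le_trans _ h) // ltW.
Qed.

Lemma next_break_in D p :
  next_break D p = 1 \/ (p < next_break D p /\ next_break D p \in D).
Proof.
elim/last_ind: D => [|D d IH]; first by left.
rewrite mem_rcons in_cons next_break_rcons /tighten.
case: ifP => [/andP[pd _]|_]; first by right; rewrite pd eqxx.
by case: IH => [->|[-> ->]]; [left|right; rewrite orbT].
Qed.

Lemma break_at_le1 D j : break_at D j <= 1.
Proof. by elim: j => [|j IH]; [exact: ler01|case/andP: (next_break_ge D IH)]. Qed.

Lemma break_at_mono D j : break_at D j <= break_at D j.+1.
Proof. by case/andP: (next_break_ge D (break_at_le1 D j)). Qed.

(** Until [1] is reached, each move strictly lowers the number of breakpoints above the current
    position, and [1] is a fixed point. *)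
Lemma break_at_last D : break_at D (size D).+1 = 1.
Proof.
pose above p := count (fun d => p < d) D.
have next_lt p : next_break D p != 1 -> (above (next_break D p) < above p)%N.
  case: (next_break_in D p) => [->|[pr rD] _]; first by rewrite eqxx.
  rewrite /above; move: rD pr; set r := next_break D p.
  elim: (D) => // d D' IH; rewrite in_cons /=.
  have sub : (count (fun d => r < d)%R D' <= count (fun d => p < d)%R D' )%N \/ r <= p.
    case: (leP r p) => [?|pr]; [by right|left].
    by apply: sub_count => d' /=; apply: lt_trans.
  case/orP => [/eqP <- pr|rD pr].
    rewrite ltxx pr add0n add1n ltnS; case: sub => //; by rewrite leNgt pr.
  rewrite -addnS leq_add ?IH //; case: (ltP r d) => // rd.
  by rewrite (lt_trans pr rd).
have: break_at D (size D).+1 = 1 \/ (above (break_at D (size D).+1) + (size D).+1 <= size D)%N.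
  (* The number of moves varies; the last [size D] stays fixed as the bound. *)
  elim: {1 2 3}(size D) => [|j].
    rewrite /break_at /=; case: (eqVneq (next_break D 0) 1) => [->|/next_lt h]; first by left.
    by right; rewrite addn1; apply: leq_trans h (count_size _ _).
  set p := break_at D j.+1 => h; rewrite /break_at iterS -/(break_at _ _) -/p.
  case: (eqVneq (next_break D p) 1) => [->|ne]; [by left|right].
  case: h => [pE|h]; last first.
    by apply: leq_trans h; rewrite addnS -addSn leq_add2r next_lt.
  have /andP[] := next_break_ge D (break_at_le1 D j.+1); rewrite -/p pE => h1 h2.
  by move: ne; rewrite pE eq_le h1 h2.
by case=> //; rewrite addnS ltnNge leq_addl.
Qed.

End NextBreak.

Definition speed (R : realType) (u : seq R) (k : nat) : R :=
  if k is k'.+1 then u`_k' else 1.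

(** * From valid agents to a feasible schedule *)

Section Schedule.
Variables (R : realType) (m b : nat) (u : b.-tuple R).
Let v := speed u.
Variables (T y : R) (a : nat -> agent R).
Hypothesis a_valid : forall i, (i < m)%N -> valid_agent v b T (a i).
Hypothesis a_usage : forall p k, (0 < k <= b)%N -> p <= 1 ->
  (\sum_(i < m) (label (a i) p == k) = (k < b) || (p <= y)%R)%N.

Variables (n : nat) (r : nat -> R).
Hypotheses (r0 : r 0 = 0) (rn : r n = 1) (r_mono : forall j, r j <= r j.+1).
Hypothesis r_gap1 : forall i j, (i < m)%N -> brk1 (a i) <= r j \/ r j.+1 <= brk1 (a i).
Hypothesis r_gap2 : forall i j, (i < m)%N -> brk2 (a i) <= r j \/ r j.+1 <= brk2 (a i).

(* Each subinterval carries the labels used at its right end. *)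
Definition cut_lengths : 'rV[R]_n := \row_j (r j.+1 - r j).
Definition cut_labels : 'M['I_b.+1]_(m, n) :=
  \matrix_(i, j) inord (label (a i) (r j.+1)).

Lemma r_le i j : (i <= j)%N -> r i <= r j.
Proof. apply: (@homo_leq _ r (fun x y => x <= y)) r_mono i j => // x p q.
exact: le_trans. Qed.

Lemma r_le1 j : (j <= n)%N -> r j <= 1.
Proof. by rewrite -rn; apply: r_le. Qed.

Lemma label_le (i : 'I_m) p : (label (a i) p <= b)%N.
Proof.
rewrite /label; have va := a_valid (ltn_ord i).
by do 2?case: ifP => _; rewrite ?(valid_lab1 va) ?(valid_lab2 va) ?(valid_lab3 va).
Qed.

Lemma cut_labelsE (i : 'I_m) j : cut_labels i j = label (a i) (r j.+1) :> nat.
Proof. by rewrite mxE inordK // ltnS label_le. Qed.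

Lemma inv_speed_cut (i : 'I_m) j :
  inv_speed u (cut_labels i j) = v (label (a i) (r j.+1)).
Proof. by rewrite /inv_speed -[val _]/(nat_of_ord _) cut_labelsE. Qed.

(** No breakpoint lies strictly inside a subinterval, so the agent keeps one vehicle there. *)
Lemma travel_step (i : 'I_m) j :
  travel v (a i) (r j.+1)
    = travel v (a i) (r j) + v (label (a i) (r j.+1)) * (r j.+1 - r j).
Proof.
have h12 := valid_brk12 (a_valid (ltn_ord i)).
have := r_gap1 j (ltn_ord i); have := r_gap2 j (ltn_ord i); have := r_mono j.
rewrite /travel /label; case: (a i) h12 => l1 l2 l3 c d /=.
move: (r j) (r j.+1) => p q h12 pq h2 h1.
case: (leP q c) => qc.
  have [qd pc pd] : [/\ q <= d, p <= c & p <= d] by split; lra.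
  by rewrite !min_l //; lra.
have cp : c <= p by case: h1 => //; lra.
rewrite (min_r cp); case: (leP q d) => qd.
  have pd : p <= d by lra.
  by rewrite !min_l //; lra.
have dp : d <= p by case: h2 => //; lra.
by rewrite (min_r dp); lra.
Qed.

Lemma travel0 (i : 'I_m) : travel v (a i) 0 = 0.
Proof.
have va := a_valid (ltn_ord i).
have h1 := valid_brk1 va; have h2 := le_trans h1 (valid_brk12 va).
by rewrite /travel !min_l // !subr0 !mulr0 !addr0.
Qed.

Lemma travel_sum (i : 'I_m) j : (j <= n)%N ->
  \sum_(k < n | (k < j)%N) inv_speed u (cut_labels i k) * cut_lengths 0 k
    = travel v (a i) (r j).
Proof.
move=> jn.
under eq_bigr do rewrite inv_speed_cut mxE.
rewrite -(big_ord_widen n (fun k => v (label (a i) (r k.+1)) * (r k.+1 - r k)) jn).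
elim: j {jn} => [|j IH]; first by rewrite big_ord0 r0 travel0.
by rewrite big_ord_recr /= IH travel_step.
Qed.

Lemma time_cut i j : time u cut_lengths cut_labels i j = travel v (a i) (r j.+1).
Proof. by rewrite -travel_sum ?ltn_ord. Qed.

Lemma arrival_cut i : arrival u cut_lengths cut_labels i = travel v (a i) 1.
Proof.
rewrite -rn -travel_sum //; apply: eq_bigl => k; by rewrite ltn_ord.
Qed.

Lemma label_unique p k (i i' : 'I_m) : (0 < k <= b)%N -> p <= 1 ->
  label (a i) p = k -> label (a i') p = k -> i = i'.
Proof.
move=> kb p1 h h'; apply/eqP/negPn/negP => ne.
have := a_usage kb p1; rewrite (bigD1 i) //= (bigD1 i') 1?eq_sym //= h h' eqxx.
by case: (_ || _).
Qed.

Lemma label_ex p k : (0 < k <= b)%N -> p <= 1 -> (k < b)%N || (p <= y) ->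
  exists i : 'I_m, label (a i) p = k.
Proof.
move=> kb p1 h; have := a_usage kb p1; rewrite h => /eqP.
case: (pickP (fun i : 'I_m => label (a i) p == k)) => [i /eqP <-|h0]; first by exists i.
by rewrite big1 // => i _; rewrite h0.
Qed.

Lemma label_used p k (i : 'I_m) : (0 < k <= b)%N -> p <= 1 ->
  label (a i) p = k -> (k < b)%N || (p <= y).
Proof.
move=> kb p1 h; have := a_usage kb p1.
by rewrite (bigD1 i) //= h eqxx; case: (_ || _).
Qed.

(** A change of label between adjacent subintervals happens at a breakpoint of the agent, where a
    give condition of [valid_agent] applies. [taker_on_time] is the mirror image with the take
    conditions. *)
Lemma giver_on_time (i : 'I_m) j k :
  label (a i) (r j) = k -> label (a i) (r j.+1) != k ->
  travel v (a i) (r j) <= handover v T k (r j).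
Proof.
have va := a_valid (ltn_ord i); have h12 := valid_brk12 va.
have := valid_give1 va; have := valid_give2 va.
have := r_gap1 j (ltn_ord i); have := r_gap2 j (ltn_ord i); have := r_mono j.
rewrite /travel /label; case: (a i) h12 => l1 l2 l3 c d /=.
move: (r j) (r j.+1) => p q h12 pq hd hc g2 g1.
case: (leP p c) => pc.
  move=> <-; case: (leP q c) => [_|qc _]; first by rewrite eqxx.
  have {hc} cp : c = p by apply/eqP; rewrite eq_le pc andbT; case: hc => //; lra.
  have pd : p <= d by lra.
  by rewrite (min_l pd) !subrr !mulr0 !addr0 -cp.
have -> : (q <= c) = false by apply/negbTE; rewrite -ltNge; lra.
case: (leP p d) => pd.
  move=> <-; case: (leP q d) => [_|qd _]; first by rewrite eqxx.
  have {hd} dp : d = p by apply/eqP; rewrite eq_le pd andbT; case: hd => //; lra.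
  by rewrite -dp subrr mulr0 addr0.
have -> : (q <= d) = false by apply/negbTE; rewrite -ltNge; lra.
by move=> ->; rewrite eqxx.
Qed.

Lemma taker_on_time (i : 'I_m) j k : k != 0%N ->
  label (a i) (r j) != k -> label (a i) (r j.+1) = k ->
  handover v T k (r j) <= travel v (a i) (r j).
Proof.
have va := a_valid (ltn_ord i); have h12 := valid_brk12 va.
have := valid_take2 va; have := valid_take3 va.
have := r_gap1 j (ltn_ord i); have := r_gap2 j (ltn_ord i); have := r_mono j.
rewrite /travel /label; case: (a i) h12 => l1 l2 l3 c d /=.
move: (r j) (r j.+1) => p q h12 pq hd hc t3 t2 k0.
case: (leP q c) => qc.
  by rewrite (le_trans pq qc) => /negP nk lk; case: nk; rewrite lk.
have {hc} cp : c <= p by case: hc => //; lra.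
rewrite (min_r cp).
case: (leP q d) => qd.
  have pd : p <= d by lra.
  rewrite pd (min_l pd) subrr mulr0 addr0.
  case: (leP p c) => pc nk lk; last by rewrite lk eqxx in nk.
  have pE : p = c by lra.
  rewrite -lk in k0 nk *; case: (t2 k0) => [/eqP|]; first by rewrite (negbTE nk).
  by rewrite pE subrr mulr0 addr0.
have {hd} dp : d <= p by case: hd => //; lra.
rewrite (min_r dp); move=> nk lk.
have [|pd] := leP p d; last first.
  by move: nk; rewrite lk !ifF ?eqxx //; apply/negbTE; rewrite -ltNge; lra.
move=> pd; have pE : p = d by lra.
rewrite -lk in k0 nk *; case: (t3 k0) => [[e1 e2]|].
  by move: nk; rewrite e1 e2; case: ifP => _; rewrite ?pd eqxx.
by rewrite pE subrr mulr0 addr0.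
Qed.

(** Exclusivity holds because label counts are at most one, availability because each bike is in use
    on an initial segment of the interval. For punctuality, [handover] separates the giver's time
    from the taker's. *)
Lemma cut_feasible : feasible u cut_lengths cut_labels.
Proof.
have lab_eq (i i' : 'I_m) j j' : cut_labels i j = cut_labels i' j' ->
    label (a i) (r j.+1) = label (a i') (r j'.+1).
  by move=> h; rewrite -!cut_labelsE h.
have lab_neq (i : 'I_m) j : cut_labels i j != ord0 ->
    (0 < label (a i) (r j.+1) <= b)%N.
  by rewrite label_le andbT lt0n -cut_labelsE -val_eqE.
have rj1 (j : 'I_n) : r j.+1 <= 1 by exact: r_le1.
split.
- split=> [j|]; first by rewrite mxE subr_ge0.
  under eq_bigr do rewrite mxE.
  by rewrite -(big_mkord xpredT (fun j => r j.+1 - r j)) telescope_sumr // rn r0 subr0.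
- move=> i j' j jE /lab_neq kb.
  have := label_used kb (rj1 j) erefl.
  have rr : r j'.+1 <= r j.+1 by apply: r_le; rewrite jE.
  move=> hu; have [|i' hi'] := @label_ex (r j'.+1) _ kb (rj1 _).
    by case/orP: hu => [->//|/(le_trans rr) ->]; rewrite orbT.
  by exists i'; apply: val_inj; rewrite /= !cut_labelsE.
- move=> i j /lab_neq kb i' ne; apply/negP => /eqP/lab_eq h.
  by move/eqP: ne; apply; apply: (label_unique kb (rj1 j)).
- move=> i i' j' j jE /lab_eq h /lab_neq kb.
  rewrite !time_cut; case: (eqVneq i i') => [->//|ne].
  have nE (i1 i2 : 'I_m) j1 : i1 != i2 -> label (a i1) (r j1.+1) = label (a i') (r j'.+1) ->
     (j1 < n)%N -> label (a i2) (r j1.+1) != label (a i') (r j'.+1).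
    move=> ne' h1 j1n; apply/negP => /eqP h2; move/eqP: ne'; apply.
    by apply: (label_unique kb _ h1 h2); apply: r_le1.
  rewrite jE in h; apply: (@le_trans _ _ (handover v T (label (a i') (r j'.+1)) (r j'.+1))).
    by apply: giver_on_time => //; apply: (nE i); rewrite // -jE.
  apply: taker_on_time => //.
    by rewrite -lt0n; case/andP: kb.
  by apply: (nE i'); rewrite 1?eq_sym.
Qed.

(** Every bike other than the one labelled [b] is in use on all subintervals. *)
Lemma cut_abandoned : (#|abandoned cut_lengths cut_labels| <= 1)%N.
Proof.
rewrite -(cards1 (ord_max : 'I_b.+1)); apply/subset_leq_card/subsetP => k.
rewrite !inE => /andP[k0]; apply: contraTT => kb.
have kb' : (0 < k < b)%N.
  rewrite lt0n (_ : (k != 0%N :> nat) = (k != ord0)) // k0 /=.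
  by rewrite ltn_neqAle -ltnS ltn_ord andbT; apply: contra kb => /eqP h; apply/eqP/val_inj.
rewrite -leNgt /bike_dist.
have [[_ <-] _ _ _] := cut_feasible; rewrite le_eqVlt; apply/orP; left.
apply/eqP; apply: eq_bigl => j; apply/esym.
case/andP: kb' => k0' kb'.
have kb1 : (0 < k <= b)%N by rewrite k0' ltnW.
have kby : (k < b)%N || (r j.+1 <= y) by rewrite kb'.
have [i hi] := label_ex kb1 (r_le1 (ltn_ord j)) kby.
by apply/existsP; exists i; apply/eqP/val_inj; rewrite /= cut_labelsE.
Qed.

Lemma cut_makespan : 0 <= T -> makespan u cut_lengths cut_labels <= T.
Proof.
move=> T0; apply: bigmax_le => // i _.
by rewrite arrival_cut; apply: valid_travel (a_valid _).
Qed.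

End Schedule.

(** * The optimal arrival time *)

Section LowerBound.
Variables (R : realType) (m b : nat) (u : b.-tuple R).
Hypothesis u01 : forall k : 'I_b, 0 < tnth u k < 1.
Hypothesis u_sorted : sorted <=%R u.

Lemma nth_u01 k : (k < b)%N -> 0 < u`_k < 1.
Proof. by move=> kb; have := u01 (Ordinal kb); rewrite (tnth_nth 0). Qed.

Lemma nth_u_le k l : (k <= l < b)%N -> u`_k <= u`_l.
Proof.
case/andP=> kl lb; apply: (sorted_leq_nth le_trans lexx 0 u_sorted) => //;
  by rewrite inE size_tuple // (leq_ltn_trans kl).
Qed.

Variables (n : nat) (x : 'rV[R]_n) (M : 'M['I_b.+1]_(m, n)).
Hypothesis xM_feasible : feasible u x M.
Let tau := makespan u x M.

Lemma arrival_le_makespan i : arrival u x M i <= tau.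
Proof. exact: (le_bigmax _ (fun i => arrival u x M i)). Qed.

Lemma bike_dist_bounds k : 0 <= bike_dist x M k <= 1.
Proof.
case: xM_feasible => -[x_ge0 <-] _ _ _; rewrite sumr_ge0 //=.
by rewrite /bike_dist big_mkcond ler_sum // => j _; case: ifP.
Qed.

(** Compared with walking, bike [k] saves [1 - u_k] per unit length, and for one rider only by
    exclusivity. Exchanging the sums over agents and subintervals adds up these savings. *)
Lemma sum_arrivals :
  m%:R - \sum_(k < b) (1 - u`_k) * bike_dist x M (lift ord0 k)
    <= m%:R * tau.
Proof.
case: xM_feasible => -[x_ge0 x_sum] _ excl _.
apply: (@le_trans _ _ (\sum_i arrival u x M i)); last first.
  rewrite mulr_natl -[X in _ *+ X](card_ord m) -sumr_const.
  by apply: ler_sum => i _; apply: arrival_le_makespan.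
rewrite /arrival exchange_big /=.
have -> : \sum_(k < b) (1 - u`_k) * bike_dist x M (lift ord0 k) =
    \sum_j x 0 j * \sum_(k < b) (1 - u`_k) * [exists i, M i j == lift ord0 k]%:R.
  under [RHS]eq_bigr do rewrite mulr_sumr.
  rewrite exchange_big; apply: eq_bigr => k _.
  rewrite /bike_dist big_mkcond mulr_sumr; apply: eq_bigr => j _.
  by case: ifP => _; rewrite ?mulr1 ?mulr0 // mulrC.
have {1}-> : m%:R = \sum_j m%:R * x 0 j by rewrite -mulr_sumr x_sum mulr1.
rewrite -sumrB; apply: ler_sum => j _.
rewrite -mulr_suml [m%:R * _]mulrC -mulrBr [leRHS]mulrC ler_wpM2l //.
rewrite lerBlDr addrC -lerBlDr.
have -> : m%:R - \sum_i inv_speed u (M i j) = \sum_i (1 - inv_speed u (M i j)).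
  by rewrite sumrB sumr_const card_ord.
have -> : \sum_i (1 - inv_speed u (M i j))
    = \sum_i \sum_(k < b) (1 - u`_k) * (M i j == lift ord0 k)%:R.
  apply: eq_bigr => i _; case: (unliftP ord0 (M i j)) => [k|] ->.
    rewrite (bigD1 k) //= eqxx mulr1 big1 ?addr0 // => l lk.
    by rewrite (inj_eq lift_inj) eq_sym (negbTE lk) mulr0.
  by rewrite subrr big1 // => k _; rewrite (negbTE (neq_lift _ _)) mulr0.
rewrite exchange_big; apply: ler_sum => k _; rewrite -mulr_sumr.
apply: ler_wpM2l; first by rewrite subr_ge0; have /andP[_ /ltW] := nth_u01 (ltn_ord k).
case: existsP => [[i /eqP iE]|no]; last first.
  by rewrite big1 // => i _; case: eqP => // /eqP h; case: no; exists i.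
rewrite (bigD1 i) //= iE eqxx big1 ?addr0 // => i' ne.
have := excl i j; rewrite iE eq_sym neq_lift => /(_ isT i' ne) /negbTE -> //.
Qed.

(** By availability the bike was ridden on all earlier subintervals, and each rider had to wait for
    the previous one; hence the induction on [j]. *)
Lemma bike_time i j k : M i j = lift ord0 k ->
  u`_k * \sum_(l < n | (l <= j)%N) x 0 l <= time u x M i j.
Proof.
case: xM_feasible => -[x_ge0 _] avail _ ontime.
case: j => j jn; elim: j i jn => [|j IH] i jn Mij.
  rewrite /time !(big_pred1 (Ordinal jn)) ?Mij //;
    by move=> l; rewrite /= -val_eqE /= leqn0.
have jn' := ltnW jn; set j0 := Ordinal jn'.
have splitS (F : 'I_n -> R) : \sum_(l < n | (l <= j.+1)%N) F l
    = \sum_(l < n | (l <= j)%N) F l + F (Ordinal jn).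
  rewrite (bigD1 (Ordinal jn)) //= addrC; congr (_ + _); apply: eq_bigl => l.
  by rewrite -val_eqE /= leq_eqVlt ltnS; case: eqVneq => [->|]; rewrite ?ltnn ?andbT.
have [|i' Mi'] := avail i j0 (Ordinal jn) erefl.
  by rewrite Mij eq_sym neq_lift.
have := ontime i i' j0 (Ordinal jn) erefl; rewrite Mi' => /(_ erefl).
rewrite Mij eq_sym neq_lift => /(_ isT) h1.
have h2 : u`_k * \sum_(l < n | (l <= j)%N) x 0 l <= time u x M i j0.
  by apply: le_trans h1; apply: IH; rewrite Mi'.
by rewrite /time /= !splitS Mij mulrDr lerD.
Qed.

Lemma slow_agent (k : 'I_b) : (0 < m)%N ->
  u`_k * bike_dist x M (lift ord0 k) + u`_0 * (1 - bike_dist x M (lift ord0 k)) <= tau.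
Proof.
case: xM_feasible => -[x_ge0 x_sum] _ _ _ m_gt0.
have u0_le l : u`_0 <= inv_speed u l.
  case: (unliftP ord0 l) => [l'|] ->; first by rewrite /inv_speed nth_u_le //=.
  by rewrite /inv_speed /= ltW //; have /andP[] := nth_u01 (leq_ltn_trans (leq0n _) (ltn_ord k)).
have u0k : u`_0 <= u`_k by rewrite nth_u_le //=.
set y := bike_dist _ _ _.
case: (pickP (fun j => [exists i, M i j == lift ord0 k])) => [j0 hj0|no]; last first.
  have -> : y = 0 by rewrite /y /bike_dist big_pred0.
  rewrite mulr0 add0r subr0 mulr1; apply: le_trans (arrival_le_makespan (Ordinal m_gt0)).
  rewrite /arrival -[u`_0]mulr1 -x_sum mulr_sumr; apply: ler_sum => j _.
  by rewrite ler_wpM2r.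
(* Take the rider on the last subinterval where the bike is used: up to its end [bike_time] applies,
   and beyond it no label beats the fastest bike. *)
case: (@arg_maxnP _ j0 (fun j => [exists i, M i j == lift ord0 k]) val hj0) => j.
case/existsP=> i /eqP Mij jmax; apply: le_trans (arrival_le_makespan i).
have -> : arrival u x M i = time u x M i j
    + \sum_(l < n | ~~ (l <= j)%N) inv_speed u (M i l) * x 0 l.
  by rewrite /arrival (bigID (fun l : 'I_n => (l <= j)%N)).
set Y := \sum_(l < n | (l <= j)%N) x 0 l.
have yY : y <= Y.
  rewrite /y /bike_dist big_mkcond /Y [leRHS]big_mkcond /=; apply: ler_sum => l _.
  by case: ifP => [/jmax /= ->|_] //; case: ifP.
have h1 : u`_k * Y <= time u x M i j by apply: bike_time.
have h2 : u`_0 * (1 - Y) <= \sum_(l < n | ~~ (l <= j)%N) inv_speed u (M i l) * x 0 l.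
  have -> : 1 - Y = \sum_(l < n | ~~ (l <= j)%N) x 0 l.
    by rewrite -x_sum (bigID (fun l : 'I_n => (l <= j)%N)) /= addrC addrK.
  by rewrite mulr_sumr; apply: ler_sum => l _; rewrite ler_wpM2r.
(* The bound is nondecreasing in the drop position, so [Y] may be lowered to [y]. *)
have h3 : 0 <= (u`_k - u`_0) * (Y - y) by rewrite mulr_ge0 ?subr_ge0.
lra.
Qed.

End LowerBound.

(** * The threshold, the initial state and the matching lower bound *)

Section Target.
Variables (R : realType) (m b : nat) (u : b.-tuple R).

Definition average : R := (\sum_(k < b) u`_k + (m - b)%:R) / m%:R.

(** The weight at which the last-rider bound, added to the bound on the sum of arrivals, cancels the
    unknown drop position. *)
Definition slope : R := (1 - speed u b) / (speed u b - speed u 1).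

(* The common value of [ub y + u1 (1 - y)] and of the average arrival time,
   as functions of [y]. *)
Definition crossing : R :=
  (\sum_(k < b) u`_k - speed u b + 1 + (m - b)%:R + slope * speed u 1)
  / (m%:R + slope).

Definition target : R :=
  if speed u b <= average then average
  else if speed u b.-1 <= crossing then crossing else speed u b.-1.

Definition drop_point : R :=
  if speed u b <= average then 1
  else (target - speed u 1) / (speed u b - speed u 1).

(* For [b = 0] the composite vehicle is itself one of the walkers. *)
Definition init_state : state R := State drop_point b 1 (m - b - (1 - b)).

Hypothesis u01 : forall k : 'I_b, 0 < tnth u k < 1.
Hypothesis u_sorted : sorted <=%R u.
Hypotheses (m_gt0 : (0 < m)%N) (bm : (b <= m)%N).

Let mR0 : 0 < m%:R :> R. Proof. by rewrite ltr0n. Qed.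

Lemma speed_bike k : (0 < k <= b)%N -> 0 < speed u k < 1.
Proof. by case: k => // k /= kb; apply: nth_u01. Qed.

Lemma speed_mono k l : (0 < k <= l)%N -> (l <= b)%N -> speed u k <= speed u l.
Proof.
by case: k => // k; case: l => // l /= kl lb; apply: nth_u_le => //; rewrite -ltnS kl.
Qed.

Lemma averageM : m%:R * average = \sum_(k < b) u`_k + (m - b)%:R.
Proof. by rewrite mulrC /average divfK // gt_eqF. Qed.

Lemma sum_u_speed : \sum_(k < b) u`_k = \sum_(1 <= l < b.+1) speed u l.
Proof. by rewrite big_add1 /= big_mkord. Qed.

Lemma average_le1 : average <= 1.
Proof.
rewrite -(ler_pM2l mR0) averageM mulr1.
have : \sum_(k < b) u`_k <= b%:R.
  rewrite -[b in leRHS](card_ord b) -sumr_const; apply: ler_sum => k _.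
  by have /andP[_ /ltW] := nth_u01 u01 (ltn_ord k).
have -> : m%:R = b%:R + (m - b)%:R :> R by rewrite -natrD subnKC.
by move: b%:R (m - b)%:R => B C; lra.
Qed.

Section Crossing.
Hypothesis slow : ~~ (speed u b <= average).

Let lt_avg : average < speed u b. Proof. by rewrite ltNge. Qed.

Lemma average_ge_min : (0 < b)%N -> speed u 1 <= average.
Proof.
move=> b0; rewrite -(ler_pM2l mR0) averageM.
have h1 : b%:R * speed u 1 <= \sum_(k < b) u`_k.
  have -> : b%:R * speed u 1 = \sum_(k < b) speed u 1.
    by rewrite sumr_const card_ord mulr_natl.
  apply: ler_sum => k _.
  exact: (@speed_mono 1 k.+1).
have /andP[_ h2] := @speed_bike 1 b0.
have h3 : (m - b)%:R * speed u 1 <= (m - b)%:R by rewrite ler_piMr // ltW.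
have -> : m%:R = b%:R + (m - b)%:R :> R by rewrite -natrD subnKC.
by rewrite mulrDl lerD.
Qed.

(** With no bike, label [b] is walking and the average is [1]; with a single bike, the average is at
    least its inverse speed. *)
Lemma slow_b_gt1 : (1 < b)%N.
Proof.
move: slow; case: b u averageM average_ge_min => [|[|b']] // u' aM aG; case/negP.
  rewrite /= -(ler_pM2l mR0) aM big_ord0 subn0 mulr1 add0r //.
exact: aG.
Qed.

Let b0 : (0 < b)%N. Proof. exact: ltnW slow_b_gt1. Qed.

Lemma slow_lt : speed u 1 < speed u b.
Proof. exact: le_lt_trans (average_ge_min b0) lt_avg. Qed.

Let D0 : 0 < speed u b - speed u 1. Proof. by rewrite subr_gt0 slow_lt. Qed.

Lemma slopeM : slope * (speed u b - speed u 1) = 1 - speed u b.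
Proof. by rewrite /slope divfK // gt_eqF. Qed.

Lemma slope_gt0 : 0 < slope.
Proof.
rewrite divr_gt0 // subr_gt0.
by have /andP[] : 0 < speed u b < 1 by rewrite speed_bike // b0 leqnn.
Qed.

Let N0 : 0 < m%:R + slope. Proof. by rewrite addr_gt0 ?slope_gt0. Qed.

Lemma crossingM : (m%:R + slope) * crossing =
  m%:R * average - speed u b + 1 + slope * speed u 1.
Proof. by rewrite mulrC /crossing divfK ?gt_eqF // averageM; lra. Qed.

(** This is what keeps [drop_point] at most [1]. *)
Lemma crossing_le : crossing <= speed u b.
Proof.
rewrite -(ler_pM2l N0) crossingM.
have h : m%:R * average <= m%:R * speed u b by rewrite ler_wpM2l // ltW.
have := slopeM; lra.
Qed.

Lemma targetE : target = Num.max crossing (speed u b.-1).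
Proof. by rewrite /target (negbTE slow) maxC; case: leP. Qed.

Lemma target_bounds : [/\ crossing <= target, speed u b.-1 <= target,
  speed u 1 <= target & target <= speed u b].
Proof.
have bb : (b.-1 <= b)%N by lia.
have b1 : (0 < 1 <= b.-1)%N by have := slow_b_gt1; lia.
have b2 : (0 < b.-1 <= b)%N by have := slow_b_gt1; lia.
have h1 := speed_mono b1 bb; have h2 := speed_mono b2 (leqnn b).
rewrite targetE; split; rewrite ?le_max ?lexx ?orbT ?h1 ?orbT //.
by rewrite ge_max crossing_le h2.
Qed.

Lemma drop_pointM : drop_point * (speed u b - speed u 1) = target - speed u 1.
Proof. by rewrite /drop_point (negbTE slow) divfK // gt_eqF. Qed.

End Crossing.

Lemma target_le1 : target <= 1.
Proof.
rewrite /target; case: ifP => [_|/negbT slow]; first exact: average_le1.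
have [_ _ _] := target_bounds slow; rewrite /target (negbTE slow) => h.
apply: le_trans h _.
have b0 := ltnW (slow_b_gt1 slow).
by have /andP[_ /ltW] : 0 < speed u b < 1 by rewrite speed_bike // b0 leqnn.
Qed.

Lemma speed_le_target k : (0 < k < b)%N -> speed u k <= target.
Proof.
case: (boolP (speed u b <= average)) => [h|slow] kb.
  by rewrite /target h; apply: le_trans h; apply: speed_mono; lia.
have [_ h _ _] := target_bounds slow; apply: le_trans h.
by apply: speed_mono; lia.
Qed.

Lemma target_ge0 : 0 <= target.
Proof.
case: (boolP (speed u b <= average)) => [h|slow].
  rewrite /target h divr_ge0 // addr_ge0 // sumr_ge0 // => k _.
  by have /andP[/ltW] := nth_u01 u01 (ltn_ord k).
have [_ _ h _] := target_bounds slow; apply: le_trans h.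
have b0 := ltnW (slow_b_gt1 slow).
by have /andP[/ltW] : 0 < speed u 1 < 1 by rewrite speed_bike // b0.
Qed.

Lemma init_size : ((b - next_bike init_state) + walkers init_state = m.-1)%N.
Proof. rewrite /=; lia. Qed.

(** If [speed u b <= average], then [valid_sum] is an equality. Otherwise it amounts to
    [crossing <= target], and [drop_point] makes the last bound of [valid_comp] an equality. *)
Lemma init_valid : valid_state (speed u) b target init_state.
Proof.
(* The conditionals treat [b = 0], where the composite stands for a walker, together with
   [0 < b]. *)
have sumE : \sum_(k < b) u`_k =
    (if (0 < b)%N then speed u b - 1 else 0) + 1 + bikes_left (speed u) b init_state
     - (if (0 < b)%N then 0 else 1).
  rewrite sum_u_speed /bikes_left /=; case: (posnP b) => b0; last by rewrite big_nat_recr //=; lra.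
  by rewrite !big_geq ?b0 //; lra.
have natE : (1 + (b - 1) + (m - b - (1 - b)) = m)%N by lia.
have walkE : (m - b - (1 - b))%:R = (m - b)%:R - (if (0 < b)%N then 0 else 1) :> R.
  case: (posnP b) => [->|b0]; first by rewrite subn0 natrB.
  by rewrite (_ : (1 - b = 0)%N) ?subn0 ?subr0 //; lia.
case: (boolP (speed u b <= average)) => [h|slow].
  have yE : drop_point = 1 by rewrite /drop_point h.
  have tE : target = average by rewrite /target h.
  split; rewrite /init_state //= ?yE ?ler01 ?lexx //; first by left; rewrite tE.
  rewrite natE tE mulrC averageM sumE walkE /comp_time /= ?yE.
  case: (posnP b) => [b0|_]; last by lra.
  have -> : speed u b = 1 := congr1 (speed u) b0.
  by lra.
have [h1 h2 h3 h4] := target_bounds slow.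
have b0 := ltnW (slow_b_gt1 slow); have D0 := slow_lt slow.
have D0' : 0 < speed u b - speed u 1 by lra.
have yE := drop_pointM slow.
have T1 := target_le1.
have /andP[u0 u1] : 0 < speed u 1 < 1 by rewrite speed_bike // b0.
have y0 : 0 <= drop_point by rewrite -(ler_pM2r D0'); lra.
have y1 : drop_point <= 1 by rewrite -(ler_pM2r D0'); lra.
split; rewrite ?[next_bike _]/= ?[comp_bike _]/= ?[comp_end _]/= ?[walkers _]/= //.
- by rewrite y0 y1.
- right; split; [|exact: slow_b_gt1|].
    rewrite /comp_time /=.
    have : 0 <= (1 - speed u 1) * (1 - drop_point) by rewrite mulr_ge0 // subr_ge0 // ltW.
    by lra.
  by lra.
rewrite natE; move: sumE; rewrite walkE b0 subr0 => sumE.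
have cM := crossingM slow; rewrite averageM sumE in cM.
have sM := slopeM slow.
have hs : slope * drop_point * (speed u b - speed u 1) = slope * (target - speed u 1).
  by rewrite -mulrA yE.
have hC : (1 - speed u b) * drop_point = slope * (target - speed u 1).
  by rewrite -hs -sM; lra.
have hT : (m%:R + slope) * crossing <= (m%:R + slope) * target.
  by rewrite ler_wpM2l // addr_ge0 // ltW // slope_gt0.
rewrite /comp_time /=; move: (bikes_left _ _ _) m%:R (m - b)%:R slope cM hC hT sM {hs sumE walkE} => S N W c cM hC hT sM.
lra.
Qed.

Lemma target_lower n (x : 'rV[R]_n) (M : 'M['I_b.+1]_(m, n)) :
  feasible_le1 u x M -> target <= makespan u x M.
Proof.
case=> fM ab; set tau := makespan u x M.
have yb k := bike_dist_bounds fM k.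
pose y (k : 'I_b) := bike_dist x M (lift ord0 k).
have term_ge0 (k : 'I_b) : 0 <= (1 - u`_k) * (1 - y k).
  have /andP[_ /ltW h1] := nth_u01 u01 (ltn_ord k).
  by have /andP[_ h2] := yb (lift ord0 k); rewrite mulr_ge0 // subr_ge0.
have hsum : m%:R * average + \sum_(k < b) (1 - u`_k) * (1 - y k) <= m%:R * tau.
  apply: le_trans (sum_arrivals u01 fM); rewrite averageM.
  have splitE : \sum_(k < b) (1 - u`_k) * (1 - y k) + \sum_(k < b) (1 - u`_k) * y k
      = b%:R - \sum_(k < b) u`_k.
    rewrite -big_split -[b in b%:R]card_ord -sumr_const -sumrB; apply: eq_bigr => k _ /=.
    by lra.
  have mE : m%:R = b%:R + (m - b)%:R :> R by rewrite -natrD subnKC.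
  rewrite mE; move: splitE; rewrite /y.
  move: (\sum_(_ < _) _) (\sum_(_ < _) _ * bike_dist _ _ _) (\sum_(_ < _) _) b%:R (m - b)%:R => S1 S2 S3 B W.
  by lra.
case: (boolP (speed u b <= average)) => [h|slow].
  rewrite /target h -(ler_pM2l mR0); apply: le_trans hsum.
  by rewrite lerDl sumr_ge0.
have b1 := slow_b_gt1 slow; rewrite targetE // ge_max; apply/andP; split.
  have lastP : (b.-1 < b)%N by lia.
  pose k := Ordinal lastP.
  have kE : u`_k = speed u b by rewrite /k /=; case: b b1 u => [|[]].
  have uE : u`_0 = speed u 1 by [].
  have h1 : m%:R * average + (1 - speed u b) * (1 - y k) <= m%:R * tau.
    apply: le_trans hsum; rewrite lerD2l (bigD1 k) //= -kE lerDl.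
    by rewrite sumr_ge0.
  have h2 := slow_agent u01 u_sorted fM k m_gt0; rewrite -/(y k) kE uE -/tau in h2.
  have c0 := slope_gt0 slow; have sM := slopeM slow.
  rewrite -(@ler_pM2l _ (m%:R + slope)) ?addr_gt0 // crossingM //.
  have h3 : slope * (speed u b * y k + speed u 1 * (1 - y k)) <= slope * tau.
    by rewrite ler_pM2l.
  (* The terms in [y k] cancel when [h1] and [h3] are added. *)
  have h4 : slope * (speed u b - speed u 1) * y k = (1 - speed u b) * y k by rewrite sM.
  by clear -h1 h3 h4; lra.
have through (k : 'I_b) : speed u b.-1 <= u`_k -> lift ord0 k \notin abandoned x M ->
    speed u b.-1 <= tau.
  move=> hk; rewrite inE eq_sym neq_lift /= -leNgt => y1.
  have := slow_agent u01 u_sorted fM k m_gt0.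
  have -> : bike_dist x M (lift ord0 k) = 1.
    by apply/eqP; rewrite eq_le y1; have /andP[_ ->] := yb (lift ord0 k).
  by rewrite mulr1 subrr mulr0 addr0; apply: le_trans.
(* Counted from [0], the two slowest bikes are [b.-1] and [b.-2]; they cannot both be abandoned. *)
have last1 : (b.-1 < b)%N by lia.
have last2 : (b.-2 < b)%N by lia.
have uE : u`_b.-2 = speed u b.-1 by case: b b1 u => [|[]].
have := @through (Ordinal last2); rewrite /= uE => /(_ (lexx _)) t2.
have hl : speed u b.-1 <= u`_b.-1 by rewrite -uE; apply: nth_u_le => //; lia.
have := @through (Ordinal last1) hl => t1.
case: (boolP (lift ord0 (Ordinal last1) \in abandoned x M)) => [a1|/t1 //].
case: (boolP (lift ord0 (Ordinal last2) \in abandoned x M)) => [a2|/t2 //].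
move/card_le1_eqP: ab => /(_ _ _ a1 a2) /lift_inj /(congr1 val) /=.
by lia.
Qed.

End Target.

(** * The program *)

Section Halting.
Variable R : realType.
Implicit Types (c : cmd) (s : store R) (Q : store R -> Prop).

Definition halts c s (t : nat) Q : Prop :=
  exists t' s', [/\ exec c s t' s', (t' <= t)%N & Q s'].

Fixpoint loop_free c : bool :=
  match c with
  | While _ _ => false
  | Seq c1 c2 => loop_free c1 && loop_free c2
  | If _ c1 c2 => loop_free c1 && loop_free c2
  | _ => true
  end.

Fixpoint cost c : nat :=
  match c with
  | Seq c1 c2 => cost c1 + cost c2
  | If _ c1 c2 => (cost c1 + cost c2).+1
  | _ => 1
  end%N.

(* A [While] is given an arbitrary value, irrelevant for loop-free commands. *)
Fixpoint den c s : store R :=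
  match c with
  | Skip | While _ _ => s
  | ISet a e1 e2 e =>
      Store (upd (icell s) a (ieval s e1) (ieval s e2) (ieval s e)) (rcell s)
  | RSet a e1 e2 e =>
      Store (icell s) (upd (rcell s) a (ieval s e1) (ieval s e2) (reval s e))
  | Seq c1 c2 => den c2 (den c1 s)
  | If e c1 c2 => if beval s e then den c1 s else den c2 s
  end.

Lemma exec_den c s : loop_free c ->
  exists2 t, exec c s t (den c s) & (t <= cost c)%N.
Proof.
elim: c s => //= [s _|a e1 e2 e s _|a e1 e2 e s _|c1 IH1 c2 IH2 s|e c1 IH1 c2 IH2 s].
- by exists 1%N => //; constructor.
- by exists 1%N => //; constructor.
- by exists 1%N => //; constructor.
- case/andP=> /IH1 h1 /IH2 h2.
  have [t1 e1 l1] := h1 s; have [t2 e2 l2] := h2 (den c1 s).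
  by exists (t1 + t2)%N; [exact: ExecSeq e1 e2 | exact: leq_add].
- case/andP=> /IH1 h1 /IH2 h2.
  have [t1 e1 l1] := h1 s; have [t2 e2 l2] := h2 s.
  case: (boolP (beval s e)) => be.
    exists t1.+1; first by apply: ExecIf; rewrite be.
    by rewrite ltnS (leq_trans l1) // leq_addr.
  exists t2.+1; first by apply: ExecIf; rewrite (negbTE be).
  by rewrite ltnS (leq_trans l2) // leq_addl.
Qed.

Lemma halts_den c s t Q : loop_free c -> (cost c <= t)%N -> Q (den c s) ->
  halts c s t Q.
Proof.
by move=> /(exec_den s)[t' e l] ct q; exists t', (den c s); rewrite (leq_trans l).
Qed.

(** The intermediate assertion replaces a concrete store by an arbitrary one, so that symbolic
    execution does not pile up updates. *)
Lemma den_seq c1 c2 s (P Q : store R -> Prop) :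
  P (den c1 s) -> (forall s', P s' -> Q (den c2 s')) -> Q (den (Seq c1 c2) s).
Proof. by move=> p; apply. Qed.

Lemma den_if e c1 c2 s Q :
  (beval s e -> Q (den c1 s)) -> (~~ beval s e -> Q (den c2 s)) ->
  Q (den (If e c1 c2) s).
Proof. by rewrite /=; case: ifP => _ h1 h2; [apply: h1 | apply: h2]. Qed.

Lemma halts_seq c1 c2 s t1 t2 Q1 Q2 :
  halts c1 s t1 Q1 -> (forall s1, Q1 s1 -> halts c2 s1 t2 Q2) ->
  halts (Seq c1 c2) s (t1 + t2)%N Q2.
Proof.
case=> t1' [s1 [e1 l1 q1]] /(_ _ q1)[t2' [s2 [e2 l2 q2]]].
by exists (t1' + t2')%N, s2; split=> //; [exact: ExecSeq e1 e2 | exact: leq_add].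
Qed.

(** Each round pays one extra step for its test, and the final failing test costs one more. *)
Lemma halts_while (Inv : nat -> store R -> Prop) e c N t s :
  (forall i s, (i < N)%N -> Inv i s -> beval s e /\ halts c s t (Inv i.+1)) ->
  (forall s, Inv N s -> ~~ beval s e) ->
  Inv 0 s -> halts (While e c) s (N * t.+1).+1 (Inv N).
Proof.
move=> body stop.
suff loop k i s1 : (i + k)%N = N -> Inv i s1 ->
    halts (While e c) s1 (k * t.+1).+1 (Inv N).
  by apply: loop.
elim: k i s1 => [|k IH] i s1.
  rewrite addn0 => -> inv; exists 1%N, s1; split=> //; apply: ExecWhileEnd.
  exact: stop.
move=> iN inv; have [|be [t1 [s2 [e1 l1 inv2]]]] := body i s1 _ inv.
  by rewrite -iN -addSnnS leq_addr.
have [|t2 [s3 [e2 l2 inv3]]] := IH i.+1 s2 _ inv2; first by rewrite addSnnS.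
exists (t1 + t2).+1, s3; split=> //; first exact: ExecWhileStep be e1 e2.
by rewrite ltnS mulSn addSn -addnS leq_add.
Qed.

Lemma halts_weaken c s t1 t2 Q1 Q2 :
  halts c s t1 Q1 -> (t1 <= t2)%N -> (forall s', Q1 s' -> Q2 s') ->
  halts c s t2 Q2.
Proof.
case=> t' [s' [e l q]] l12 imp; exists t', s'; split=> //; last exact: imp.
exact: leq_trans l12.
Qed.

End Halting.

(** * The code *)

Definition ivar a := IGet a (ICst 0) (ICst 0).
Definition rvar a := RGet a (ICst 0) (ICst 0).
Definition iarr a e := IGet a e (ICst 0).
Definition rarr a e := RGet a e (ICst 0).
Definition iset a e := ISet a (ICst 0) (ICst 0) e.
Definition rset a e := RSet a (ICst 0) (ICst 0) e.
Definition iaset a i e := ISet a i (ICst 0) e.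
Definition raset a i e := RSet a i (ICst 0) e.
Definition isucc e := IAdd e (ICst 1).
Definition rone := ROfI (ICst 1).
Definition incr a := iset a (isucc (ivar a)).
Definition seqs (cs : seq cmd) := foldr Seq Skip cs.

(* Natural arrays: 0 m, 1 b, 2 n, 3 M, 4 i, 5 comp_bike, 6 next_bike,
   7 walkers, 8 j, 9 lab1, 10 lab2, 11 lab3.
   Real arrays: 0 u, 1 x, 2 speed, 3 sum of u, 4 target, 5 comp_end, 6 brk1,
   7 brk2, 8 current breakpoint, 9 next breakpoint, 10 average, 11 slope. *)

Definition speed_init := seqs
  [:: raset 2 (ICst 0) rone; rset 3 (ROfI (ICst 0)); iset 4 (ICst 0)].

Definition speed_body := seqs
  [:: raset 2 (isucc (ivar 4)) (rarr 0 (ivar 4));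
      rset 3 (RAdd (rvar 3) (rarr 0 (ivar 4)));
      incr 4].

Definition speed_prog :=
  Seq speed_init (While (ILe (isucc (ivar 4)) (ivar 1)) speed_body).

Definition target_prog :=
  let ub := rarr 2 (ivar 1) in
  let u1 := rarr 2 (ICst 1) in
  let up := rarr 2 (ISub (ivar 1) (ICst 1)) in
  let walk := ROfI (ISub (ivar 0) (ivar 1)) in
  seqs
  [:: rset 10 (RDiv (RAdd (rvar 3) walk) (ROfI (ivar 0)));
      If (RLe ub (rvar 10))
        (Seq (rset 4 (rvar 10)) (rset 5 rone))
        (seqs
          [:: rset 11 (RDiv (RSub rone ub) (RSub ub u1));
              rset 4 (RDiv (RAdd (RAdd (RAdd (RSub (rvar 3) ub) rone) walk)
                              (RMul (rvar 11) u1))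
                           (RAdd (ROfI (ivar 0)) (rvar 11)));
              If (RLe up (rvar 4)) Skip (rset 4 up);
              rset 5 (RDiv (RSub (rvar 4) u1) (RSub ub u1))]);
      iset 5 (ivar 1);
      iset 6 (ICst 1);
      iset 7 (ISub (ISub (ivar 0) (ivar 1)) (ISub (ICst 1) (ivar 1)));
      iset 4 (ICst 0)].

Definition put_agent l1 l2 l3 c d := seqs
  [:: iaset 9 (ivar 4) l1; iaset 10 (ivar 4) l2; iaset 11 (ivar 4) l3;
      raset 6 (ivar 4) c; raset 7 (ivar 4) d].

(** The new composite end is read back from the breakpoint just stored for the agent, which spares a
    second evaluation of the quotient. *)
Definition step_prog :=
  let z := rvar 5 in let k := ivar 5 in let s := ivar 6 in let w := ivar 7 in
  let vk := rarr 2 k in let vs := rarr 2 s in let T := rvar 4 in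
  let C := RAdd (RMul vk z) (RSub rone z) in
  let decr_w := iset 7 (ISub w (ICst 1)) in
  Seq
   (If (BAnd (RLe T C) (ILe (isucc s) (ivar 1)))
     (seqs [:: put_agent k (ICst 0) s z
                (RDiv (RSub (RAdd (RSub T (RMul vk z)) z) vs) (RSub rone vs));
               rset 5 (rarr 7 (ivar 4)); iset 5 s; incr 6])
   (If (BAnd (BNot (RLe T C)) (ILe (ICst 1) w))
     (seqs [:: put_agent (ICst 0) k (ICst 0) (RDiv (RSub T C) (RSub rone vk)) z;
               rset 5 (rarr 6 (ivar 4)); decr_w])
   (If (ILe (isucc s) (ivar 1))
     (Seq (put_agent s s s rone rone) (incr 6))
     (Seq (put_agent (ICst 0) (ICst 0) (ICst 0) rone rone) decr_w))))
   (incr 4).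

(** The loop test [i + 2 <= m] leaves agent [m - 1] to the final composite. The size [2 m + 1]
    allows two breakpoints per agent and a last cut at [1]. *)
Definition agents_prog := seqs
  [:: While (ILe (IAdd (ivar 4) (ICst 2)) (ivar 0)) step_prog;
      put_agent (ivar 5) (ICst 0) (ICst 0) (rvar 5) rone;
      iset 2 (isucc (IAdd (ivar 0) (ivar 0)));
      rset 8 (ROfI (ICst 0));
      iset 8 (ICst 0)].

Definition tighten_prog a :=
  let d := rarr a (ivar 4) in
  If (BAnd (BNot (RLe d (rvar 8))) (BNot (RLe (rvar 9) d))) (rset 9 d) Skip.

Definition next_break_body := seqs [:: tighten_prog 6; tighten_prog 7; incr 4].

Definition label_body :=
  let put e := ISet 3 (ivar 4) (ivar 8) (iarr e (ivar 4)) in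
  Seq (If (RLe (rvar 9) (rarr 6 (ivar 4))) (put 9)
      (If (RLe (rvar 9) (rarr 7 (ivar 4))) (put 10) (put 11)))
    (incr 4).

Definition for_agents body := While (ILe (isucc (ivar 4)) (ivar 0)) body.

(** One scan over the agents finds the right end of the subinterval, a second one writes the labels
    used there. *)
Definition column_body := seqs
  [:: Seq (rset 9 rone) (iset 4 (ICst 0));
      for_agents next_break_body;
      Seq (raset 1 (ivar 8) (RSub (rvar 9) (rvar 8))) (iset 4 (ICst 0));
      for_agents label_body;
      Seq (rset 8 (rvar 9)) (incr 8)].

Definition bike_prog := seqs
  [:: speed_prog; target_prog; agents_prog;
      While (ILe (isucc (ivar 8)) (ivar 2)) column_body].

(** * Loop invariants, running time and optimality of the output *)

Section Correctness.
Variables (R : realType) (m b : nat) (u : b.-tuple R).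
Hypothesis u01 : forall k : 'I_b, 0 < tnth u k < 1.
Hypothesis u_sorted : sorted <=%R u.
Hypotheses (m_gt0 : (0 < m)%N) (bm : (b <= m)%N).
Let v := speed u.
Let T := target m u.
Implicit Types s : store R.

Record speed_inv (i : nat) s : Prop := SpeedInv {
  sp_m : icell s 0 0 0 = m;
  sp_b : icell s 1 0 0 = b;
  sp_i : icell s 4 0 0 = i;
  sp_u : forall k, rcell s 0 k 0 = u`_k;
  sp_v : forall k, (k <= i)%N -> rcell s 2 k 0 = v k;
  sp_sum : rcell s 3 0 0 = \sum_(k < i) u`_k }.

Lemma speed_prog_ok : halts speed_prog (input m u) (4 + (b * 5).+1) (speed_inv b).
Proof.
apply: (@halts_seq _ _ _ _ _ _ (speed_inv 0)).
  apply: halts_den => //; split=> //=; last by rewrite big_ord0.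
  by case.
move=> s; apply: halts_while => [i s1 ib inv|s1 inv].
  split; first by rewrite /= (sp_i inv) (sp_b inv) addn1.
  apply: halts_den => //; case: inv => h0 h1 h4 hu hv hs.
  split=> //=; rewrite /upd /= ?h4 ?hu ?hs ?addn1 //.
    move=> k; rewrite leq_eqVlt => /orP[/eqP ->|ki]; first by rewrite eqxx.
    by rewrite (ltn_eqF ki) hv.
  by rewrite big_ord_recr.
by rewrite /= (sp_i inv) (sp_b inv) addn1 ltnn.
Qed.

Definition state_cells s (st : state R) : Prop :=
  [/\ icell s 5 0 0 = comp_bike st, icell s 6 0 0 = next_bike st,
      icell s 7 0 0 = walkers st & rcell s 5 0 0 = comp_end st].

Definition agent_cells s (i : nat) (a : agent R) : Prop :=
  [/\ icell s 9 i 0 = lab1 a, icell s 10 i 0 = lab2 a, icell s 11 i 0 = lab3 a,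
      rcell s 6 i 0 = brk1 a & rcell s 7 i 0 = brk2 a].

Let st0 := init_state m u.
Let st i := state_at v b T st0 i.
Let a i := agent_at v b T m st0 i.

Record agents_inv (i : nat) s : Prop := AgentsInv {
  ag_m : icell s 0 0 0 = m;
  ag_b : icell s 1 0 0 = b;
  ag_i : icell s 4 0 0 = i;
  ag_v : forall k, (k <= b)%N -> rcell s 2 k 0 = v k;
  ag_T : rcell s 4 0 0 = T;
  ag_st : state_cells s (st i);
  ag_a : forall i', (i' < i)%N -> agent_cells s i' (a i') }.

Definition target_base s : Prop :=
  [/\ icell s 0 0 0 = m, icell s 1 0 0 = b,
      forall k, (k <= b)%N -> rcell s 2 k 0 = v k
    & rcell s 3 0 0 = \sum_(k < b) u`_k].

Lemma target_prog_ok s : speed_inv b s -> halts target_prog s 20 (agents_inv 0).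
Proof.
case=> h0 h1 h4 hu hv hs; apply: halts_den => //; rewrite /target_prog.
apply: (den_seq (P := fun s => target_base s /\ rcell s 10 0 0 = average m u)).
  by rewrite /target_base /= /upd /= h0 h1 hs.
move=> {h0 h1 h4 hu hv hs}s1 [[h0 h1 hv hs] hA].
pose P2 s := [/\ target_base s, rcell s 4 0 0 = T & rcell s 5 0 0 = drop_point m u].
apply: (den_seq (P := P2)); last first.
  move=> {h0 h1 hv hs hA}s2 [[h0 h1 hv hs] hT hz].
  by split; rewrite /= /upd /= ?h0 ?h1.
apply: (den_if (Q := P2)) => [h|slow].
  rewrite /= h1 hA (hv b) // in h.
  by rewrite /P2 /target_base /T /target /drop_point -/v h /= /upd /= ?h0 ?h1 ?hs ?hA.
rewrite /= h1 hA (hv b) // in slow.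
(* Since [2 <= b], cell [1] of the speed array is among those known to be filled. *)
have b1 := slow_b_gt1 u01 u_sorted m_gt0 bm slow.
apply: (den_seq (Q := P2) (P := fun s => target_base s /\ rcell s 11 0 0 = slope u)).
  by rewrite /target_base /= /upd /= h0 h1 hs !hv // ltnW.
move=> {h0 h1 hv hs hA}s2 [[h0 h1 hv hs] hslope].
apply: (den_seq (Q := P2) (P := fun s => target_base s /\ rcell s 4 0 0 = crossing m u)).
  by rewrite /target_base /= /upd /= h0 h1 hs hslope !hv // ltnW.
move=> {h0 h1 hv hs hslope}s3 [[h0 h1 hv hs] hc].
pose P3 s := target_base s /\ rcell s 4 0 0 = T.
apply: (den_seq (Q := P2) (P := P3)).
  apply: (den_if (Q := P3)); rewrite /P3 /T /target (negbTE slow) -/v /= h1 hc hv ?leq_subr // subn1; [by move=> ->|move=> /negbTE ->].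
  by rewrite /target_base /upd /= ?h0 ?h1 ?hs ?hv ?leq_pred.
move=> {h0 h1 hv hs hc}s4 [[h0 h1 hv hs] hT].
rewrite /P2 /target_base /= /upd /= h0 h1 hs hT !hv // ?(ltnW b1) //.
by rewrite /drop_point (negbTE slow).
Qed.

Let st_ok i : (i <= m.-1)%N -> valid_state v b T (st i).
Proof.
move=> im.
have [] := @state_at_valid R v b T erefl _ _ _ m st0 _ _ i im => //.
- exact: speed_bike.
- exact: speed_le_target.
- exact: target_le1.
- exact: init_valid.
- exact: init_size.
Qed.

Lemma step_prog_ok i s : (i < m.-1)%N -> agents_inv i s ->
  halts step_prog s 50 (agents_inv i.+1).
Proof.
move=> im [h0 h1 h4 hv hT [hk hn hw hz] ha]; apply: halts_den => //.
have ai : a i = (step v b T (st i)).1 by rewrite /a /agent_at im.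
have si : st i.+1 = (step v b T (st i)).2 by [].
have kb := valid_bike (st_ok (ltnW im)).
(* All that is needed of the new store, including what is unchanged, is extracted here once; the
   store is then generalized. *)
have Hs : [/\ state_cells (den step_prog s) (step v b T (st i)).2,
              agent_cells (den step_prog s) i (step v b T (st i)).1,
              forall i', i' != i -> agent_cells s i' (a i') ->
                agent_cells (den step_prog s) i' (a i')
            & [/\ icell (den step_prog s) 0 0 0 = m,
                  icell (den step_prog s) 1 0 0 = b,
                  icell (den step_prog s) 4 0 0 = i.+1,
                  rcell (den step_prog s) 2 = rcell s 2
                & rcell (den step_prog s) 4 0 0 = T]].
  clear ai si ha; move: kb hk hn hw hz; case: (st i) => z k n w /= kb hk hn hw hz.
  rewrite /step_prog /step /comp_time /= hz hk hn hw hT h1 h4 (hv k) // addn1.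
  case: ifP => [/andP[_ nb]|_] /=.
    rewrite /upd /= ?eqxx /= ?hz ?hk ?hn ?hw ?hT ?h4 ?h0 ?h1 ?(hv k) ?(hv n) ?(ltnW nb) //.
    rewrite /state_cells /agent_cells /=.
    split=> //; rewrite ?eqxx ?addn1 //.
    by move=> i' /negbTE -> .
  case: ifP => [_|_] /=.
    rewrite /upd /= ?eqxx /= ?hz ?hk ?hn ?hw ?hT ?h4 ?h0 ?h1 ?(hv k) //.
    rewrite /state_cells /agent_cells /=.
    split=> //; rewrite ?eqxx ?addn1 ?subn1 //.
    by move=> i' /negbTE -> .
  case: ifP => [_|_] /=.
    rewrite /upd /= ?eqxx /= ?hz ?hk ?hn ?hw ?hT ?h4 ?h0 ?h1 //.
    rewrite /state_cells /agent_cells /=.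
    split=> //; rewrite ?eqxx ?addn1 //.
    by move=> i' /negbTE -> .
  rewrite /upd /= ?eqxx /= ?hz ?hk ?hn ?hw ?hT ?h4 ?h0 ?h1 //.
  rewrite /state_cells /agent_cells /=.
  split=> //; rewrite ?eqxx ?addn1 ?subn1 //.
  by move=> i' /negbTE -> .
move: (den _ _) Hs => s' [g1 g2 g3 [g4 g5 g6 g7 g8]]; split=> //.
  by move=> k; rewrite g7; apply: hv.
move=> i'; rewrite ltnS leq_eqVlt => /orP[/eqP ->|lt]; first by rewrite ai.
by apply: g3; [rewrite ltn_eqF | apply: ha].
Qed.

(** Restricting to the first [i] agents turns [next_break (D i)] into the value held by the scan
    after [i] rounds. *)
Let D i := flatten [seq [:: brk1 (a i'); brk2 (a i')] | i' <- iota 0 i].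
Let r := break_at (D m).

Record cols_inv (j : nat) s : Prop := ColsInv {
  cl_m : icell s 0 0 0 = m;
  cl_n : icell s 2 0 0 = (m + m).+1;
  cl_j : icell s 8 0 0 = j;
  cl_r : rcell s 8 0 0 = r j;
  cl_a : forall i, (i < m)%N -> agent_cells s i (a i);
  cl_x : forall j', (j' < j)%N -> rcell s 1 j' 0 = r j'.+1 - r j';
  cl_M : forall i j', (i < m)%N -> (j' < j)%N ->
    icell s 3 i j' = label (a i) (r j'.+1) }.

Lemma agents_prog_ok s : agents_inv 0 s ->
  halts agents_prog s ((m.-1 * 51).+1 + 20)%N (cols_inv 0).
Proof.
move=> inv; rewrite /agents_prog.
apply: (@halts_seq _ _ _ _ _ _ (agents_inv m.-1)).
  apply: halts_while inv => [i s1 im inv1|s1 [h0 h1 h4 _ _ _ _]].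
    split; last exact: step_prog_ok.
    by rewrite /= (ag_i inv1) (ag_m inv1); clear -im; lia.
  by rewrite /= h0 h4; clear; lia.
move=> s1 [h0 h1 h4 hv hT [hk hn hw hz] ha]; apply: halts_den => //.
split; rewrite /= /upd /= ?h0 ?addnn //.
  by rewrite addn1.
move=> i im; have [->|ne] := eqVneq i m.-1.
  by rewrite /agent_cells /= h4 !eqxx /a /agent_at ltnn hk hz.
have /ha [] : (i < m.-1)%N by clear -im ne; lia.
by rewrite /agent_cells /= h4 (negbTE ne).
Qed.

Lemma D_rcons i : D i.+1 = rcons (rcons (D i) (brk1 (a i))) (brk2 (a i)).
Proof. by rewrite /D -addn1 iotaD map_cat flatten_cat /= -!cats1 -catA. Qed.

Lemma D_size i : size (D i) = (i + i)%N.
Proof. by elim: i => // i IH; rewrite D_rcons !size_rcons IH addSn addnS. Qed.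

Definition next_inv j i s : Prop :=
  [/\ cols_inv j s, icell s 4 0 0 = i & rcell s 9 0 0 = next_break (D i) (r j)].

Lemma tighten_prog_ok c j i (p d : R) s :
  cols_inv j s -> icell s 4 0 0 = i -> rcell s 9 0 0 = p -> rcell s c i 0 = d ->
  [/\ cols_inv j (den (tighten_prog c) s),
      icell (den (tighten_prog c) s) 4 0 0 = i
    & rcell (den (tighten_prog c) s) 9 0 0 = tighten (r j) p d].
Proof.
move=> [h0 h2 h8 hr ha hx hM] h4 hp hd.
rewrite /tighten /= h4 hp hd hr -!ltNge; by case: ifP.
Qed.

Lemma next_break_body_ok j i s : (i < m)%N -> next_inv j i s ->
  halts next_break_body s 10 (next_inv j i.+1).
Proof.
move=> im [inv h4 h9]; apply: halts_den => //.
have [inv1 h41 h91] := tighten_prog_ok inv h4 h9 (erefl (rcell s 6 i 0)).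
have [_ _ _ c6 _] := cl_a inv im.
rewrite -[den _ s]/(den (incr 4) (den (tighten_prog 7) (den (tighten_prog 6) s))).
move: (den (tighten_prog 6) s) inv1 h41 h91 => s1 inv1 h41 h91.
have [inv2 h42 h92] := tighten_prog_ok inv1 h41 h91 (erefl (rcell s1 7 i 0)).
have [_ _ _ _ c7] := cl_a inv1 im.
move: (den (tighten_prog 7) s1) inv2 h42 h92 => s2 [g0 g2 g8 gr ga gx gM] h42 h92.
split; [by split | by rewrite /= /upd /= h42 addn1 |].
by rewrite D_rcons !next_break_rcons -[LHS]/(rcell s2 9 0 0) h92 c6 c7.
Qed.

Definition label_inv j i s : Prop :=
  [/\ cols_inv j s, icell s 4 0 0 = i, rcell s 9 0 0 = r j.+1,
      rcell s 1 j 0 = r j.+1 - r j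
    & forall i', (i' < i)%N -> icell s 3 i' j = label (a i') (r j.+1)].

Lemma label_body_ok j i s : (i < m)%N -> label_inv j i s ->
  halts label_body s 10 (label_inv j i.+1).
Proof.
move=> im [[h0 h2 h8 hr ha hx hM] h4 h9 h1 hl]; apply: halts_den => //.
have [c9 c10 c11 c6 c7] := ha i im.
suff H : [/\ cols_inv j (den label_body s), icell (den label_body s) 4 0 0 = i.+1,
    rcell (den label_body s) = rcell s, icell (den label_body s) 3 i j = label (a i) (r j.+1)
  & forall i', i' != i -> icell (den label_body s) 3 i' j = icell s 3 i' j].
  move: (den label_body s) H => s' [g1 g2 g3 g4 g5]; split; rewrite ?g3 //.
  move=> i'; rewrite ltnS leq_eqVlt => /orP[/eqP -> //|lt].
  by rewrite g5 ?hl // ltn_eqF.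
rewrite /label_body /label /= h9 h4 h8 c6 c7.
have upd_col (f : nat -> nat -> nat) l : (forall i' j', (i' < m)%N -> (j' < j)%N ->
     f i' j' = label (a i') (r j'.+1)) ->
   forall i' j', (i' < m)%N -> (j' < j)%N ->
     (if (i' == i) && (j' == j) then l else f i' j') = label (a i') (r j'.+1).
  by move=> hf i' j' lt1 lt2; rewrite (ltn_eqF lt2) andbF hf.
case: ifP => _ /=; last case: ifP => _ /=;
  rewrite /upd /= ?eqxx ?h4 ?addn1 ?c9 ?c10 ?c11.
- split=> //; last by move=> i' /negbTE ->.
  by split=> //; exact: upd_col.
- split=> //; last by move=> i' /negbTE ->.
  by split=> //; exact: upd_col.
- split=> //; last by move=> i' /negbTE ->.
  by split=> //; exact: upd_col.
Qed.

Lemma column_body_ok j s : cols_inv j s ->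
  halts column_body s (2 + ((m * 11).+1 + (2 + ((m * 11).+1 + 3))))%N
    (cols_inv j.+1).
Proof.
move=> inv; apply: (@halts_seq _ _ _ _ _ _ (next_inv j 0)).
  apply: halts_den => //; case: inv => h0 h2 h8 hr ha hx hM.
  by split=> //=; split.
move=> s1 inv1; apply: (@halts_seq _ _ _ _ _ _ (next_inv j m)).
  apply: halts_while inv1 => [i s2 im inv2|s2 [inv2 h4 _]].
    split; last exact: next_break_body_ok.
    by case: inv2 => inv2 h4 _; rewrite /= (cl_m inv2) h4 addn1.
  by rewrite /= (cl_m inv2) h4 addn1 ltnn.
move=> s2 [[h0 h2 h8 hr ha hx hM] h4 h9].
apply: (@halts_seq _ _ _ _ _ _ (label_inv j 0)).
  apply: halts_den => //; split=> //=; rewrite /upd /= ?h8 ?eqxx ?h9 ?hr //.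
  split=> //= j' lt; by rewrite /upd /= ?h8 (ltn_eqF lt) hx.
move=> s3 inv3; apply: (@halts_seq _ _ _ _ _ _ (label_inv j m)).
  apply: halts_while inv3 => [i s4 im inv4|s4 [inv4 h44 _ _ _]].
    split; last exact: label_body_ok.
    by case: inv4 => inv4 h44 _ _ _; rewrite /= (cl_m inv4) h44 addn1.
  by rewrite /= (cl_m inv4) h44 addn1 ltnn.
move=> s4 [[g0 g2 g8 gr ga gx gM] g4 g9 g1 gl].
apply: halts_den => //; split; rewrite /= /upd /= ?g8 ?addn1 //.
  by move=> j'; rewrite ltnS leq_eqVlt => /orP[/eqP -> //|]; apply: gx.
move=> i j' im; rewrite ltnS leq_eqVlt => /orP[/eqP ->|lt]; first exact: gl.
exact: gM.
Qed.

Lemma bike_prog_ok : halts bike_prog (input m u) (1000 * m ^ 2)%N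
  (cols_inv (m + m).+1).
Proof.
(* The [2 m + 1] columns cost [22 m + 10] steps each and everything else is linear in [m], so [1000]
   is generous. *)
apply: (@halts_weaken _ _ _ (4 + (b * 5).+1 + (20 + ((m.-1 * 51).+1 + 20 +
   (((m + m).+1 * (2 + ((m * 11).+1 + (2 + ((m * 11).+1 + 3)))).+1).+1 + 1))))%N _
  (cols_inv (m + m).+1) _) => //; last first.
  by clear -m_gt0 bm; nia.
apply: halts_seq speed_prog_ok _ => s1 /target_prog_ok h1.
apply: halts_seq h1 _ => s2 /agents_prog_ok h2.
apply: halts_seq h2 _ => s3 inv3.
apply: (@halts_seq _ _ _ _ _ _ (cols_inv (m + m).+1)).
  apply: halts_while inv3 => [j s4 jn inv4|s4 inv4].
    split; last exact: column_body_ok.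
    by rewrite /= (cl_n inv4) (cl_j inv4) addn1.
  by rewrite /= (cl_n inv4) (cl_j inv4) addn1 ltnn.
by move=> s4 inv4; apply: halts_den.
Qed.

Lemma a_valid i : valid_agent v b T (a i).
Proof.
apply: agent_at_valid => //.
- exact: speed_bike.
- exact: speed_le_target.
- exact: target_le1.
- exact: init_valid.
- exact: init_size.
Qed.

Lemma a_usage p k : (0 < k <= b)%N -> p <= 1 ->
  (\sum_(i < m) (label (a i) p == k) = (k < b) || (p <= drop_point m u)%R)%N.
Proof.
case/andP=> k0 kb p1; rewrite agents_usage //.
- rewrite /usage /= k0; move: kb; rewrite leq_eqVlt => /predU1P[->|kb].
    by rewrite eqxx ltnn andbT addn0.
  by rewrite kb (gtn_eqF kb) andbF.
- exact: speed_bike.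
- exact: speed_le_target.
- exact: target_le1.
- exact: init_valid.
- exact: init_size.
Qed.

Lemma r_gap i j d : (i < m)%N -> d \in [:: brk1 (a i); brk2 (a i)] ->
  d <= r j \/ r j.+1 <= d.
Proof.
move=> im di; apply: next_break_gap; apply/flattenP.
exists [:: brk1 (a i); brk2 (a i)] => //.
by apply: (map_f (fun i => [:: brk1 (a i); brk2 (a i)])); rewrite mem_iota.
Qed.

Lemma bike_prog_correct :
  exists (t : nat) (s : store R) (n : nat) (x : 'rV[R]_n) (M : 'M['I_b.+1]_(m, n)),
    [/\ exec bike_prog (input m u) t s, (t <= 1000 * m ^ 2)%N,
        outputs s x M & optimal_le1 u x M].
Proof.
have [t [s [e l inv]]] := bike_prog_ok.
have rn : r (m + m).+1 = 1 by rewrite -D_size; apply: break_at_last.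
have va i : (i < m)%N -> valid_agent v b T (a i) by move=> _; apply: a_valid.
have r_mono j : r j <= r j.+1 by apply: break_at_mono.
have g1 i j : (i < m)%N -> brk1 (a i) <= r j \/ r j.+1 <= brk1 (a i).
  by move=> im; apply: r_gap im _; rewrite inE eqxx.
have g2 i j : (i < m)%N -> brk2 (a i) <= r j \/ r j.+1 <= brk2 (a i).
  by move=> im; apply: r_gap im _; rewrite !inE eqxx orbT.
exists t, s, (m + m).+1, (cut_lengths _ r), (cut_labels m b a _ r); split=> //.
  case: inv => h0 h2 h8 hr ha hx hM; split=> // [j|i j]; first by rewrite mxE hx.
  by rewrite (cut_labelsE va) hM.
have fM := cut_feasible va a_usage (erefl : r 0 = 0) rn r_mono g1 g2.
split; first by split=> //; apply: (cut_abandoned va a_usage (erefl : r 0 = 0) rn r_mono g1 g2).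
move=> n' x' M' fM'; apply: le_trans (target_lower u01 u_sorted m_gt0 bm fM').
apply: (cut_makespan va (erefl : r 0 = 0) rn r_mono g1 g2).
exact: target_ge0.
Qed.

End Correctness.

Theorem theorem2 (R : realType) :
  exists (P : cmd) (c d : nat),
  forall (m b : nat) (u : b.-tuple R),
    (1 <= m)%N -> (b <= m)%N ->
    (forall k : 'I_b, 0 < tnth u k < 1) ->
    sorted <=%R u ->
    exists (t : nat) (s : store R)
           (n : nat) (x : 'rV[R]_n) (M : 'M['I_b.+1]_(m, n)),
      [/\ exec P (input m u) t s,
          (t <= c * m ^ d)%N,
          outputs s x M
        & optimal_le1 u x M].
Proof.
exists bike_prog, 1000%N, 2%N => m b u m_gt0 bm u01 u_sorted.
exact: bike_prog_correct.
Qed.
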